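(* Let $V$ be an infinite-dimensional vector space over a field $\mathbb{F}$, and let $u\in\mathrm{SP}_f(V)$ have determinant $\pm 1$. Then, in the algebra $\mathcal{A}(V)$, $u$ is the product of three involutions, and also of one unipotent element of index $2$ and two involutions, and also of one involution and two unipotent elements of index $2$ (in any prescribed order). Moreover, if $u$ has determinant $1$ then it is the product, in $\mathcal{A}(V)$, of three unipotent elements of index $2$.
   Context: $\mathrm{End}(V)$ is the algebra of all endomorphisms of $V$, $\mathrm{End}_f(V)$ its two-sided ideal of finite-rank endomorphisms, and $\mathcal{A}(V):=\mathbb{F}\,\mathrm{id}_V\oplus\mathrm{End}_f(V)$, a subalgebra of $\mathrm{End}(V)$. $\mathrm{SP}_f(V)$ is the group of all automorphisms of $V$ of the form $\mathrm{id}_V+w$ with $w\in\mathrm{End}_f(V)$. For $u\in\mathrm{SP}_f(V)$, the determinant of $u$ is the determinant of the endomorphism $u_{|W}$ of $W$ induced by $u$, where $W$ is any finite-dimensional linear subspace of $V$ that includes $\mathrm{Im}(u-\mathrm{id}_V)$ (this does not depend on the choice of $W$). In a unital algebra, an element $x$ is an involution if $x^2=1$, and is unipotent of index $2$ if $(x-1)^2=0$. *)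

(* Defs.v *)
From HB Require Import structures.
From mathcomp Require Import all_boot all_algebra.
From mathcomp Require Import boolp classical_sets.

Set Implicit Arguments.
Unset Strict Implicit.
Unset Printing Implicit Defensive.

Import GRing.Theory.
Local Open Scope ring_scope.
Local Open Scope classical_set_scope.

Definition involution (R : pzRingType) : set R := [set x | x ^+ 2 = 1].

Definition unipotent2 (R : pzRingType) : set R := [set x | (x - 1) ^+ 2 = 0].

Definition prod3 (R : pzRingType) (X Y Z : set R) : set R :=
  [set u | exists x y z, [/\ X x, Y y, Z z & u = x * y * z]].

Section LinearAlgebra.
Variables (F : fieldType) (V : lmodType F).

Definition lspan n (e : 'I_n -> V) : set V :=
  [set v | exists c : 'I_n -> F, v = \sum_(i < n) c i *: e i].

Definition lfree n (e : 'I_n -> V) : Prop :=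
  forall c : 'I_n -> F, \sum_(i < n) c i *: e i = 0 -> forall i, c i = 0.

Definition finite_dim (W : set V) : Prop :=
  exists n (e : 'I_n -> V), W = lspan e.

(* An alias of {linear V -> V} carrying the ring structure whose product is
   composition; it is only a pzRingType because V may be trivial. *)
Definition endo : Type := {linear V -> V}.

End LinearAlgebra.

Section EndoRing.
Variables (F : fieldType) (V : lmodType F).
Implicit Types f g h : endo V.

HB.instance Definition _ := gen_eqMixin (endo V).
HB.instance Definition _ := gen_choiceMixin (endo V).

Lemma endoP f g : (forall v, f v = g v) -> f = g.
Proof.
case: f g => f [[fa] [fs]] [g [[ga] [gs]]] /= fg.
have {}fg : f = g by apply: functional_extensionality_dep.
case: _ / fg ga gs => ga gs.
by rewrite (Prop_irrelevance fa ga) (Prop_irrelevance fs gs).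
Qed.

Definition endo_zero : endo V := (\0 : V -> V).
Definition endo_opp f : endo V := -%R \o f.
Definition endo_add f g : endo V := f \+ g.
Definition endo_one : endo V := idfun.
Definition endo_mul f g : endo V := f \o g.
Definition endo_scale (a : F) f : endo V := a \*: f.

Fact endo_addA : associative endo_add.
Proof. by move=> f g h; apply: endoP => v /=; rewrite addrA. Qed.
Fact endo_addC : commutative endo_add.
Proof. by move=> f g; apply: endoP => v /=; rewrite addrC. Qed.
Fact endo_add0 : left_id endo_zero endo_add.
Proof. by move=> f; apply: endoP => v /=; rewrite add0r. Qed.
Fact endo_addN : left_inverse endo_zero endo_opp endo_add.
Proof. by move=> f; apply: endoP => v /=; rewrite addNr. Qed.
HB.instance Definition _ := GRing.isZmodule.Build (endo V)
  endo_addA endo_addC endo_add0 endo_addN.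

Fact endo_mulA : associative endo_mul.
Proof. by move=> f g h; apply: endoP. Qed.
Fact endo_mul1 : left_id endo_one endo_mul.
Proof. by move=> f; apply: endoP. Qed.
Fact endo_mulr1 : right_id endo_one endo_mul.
Proof. by move=> f; apply: endoP. Qed.
Fact endo_mulDl : left_distributive endo_mul endo_add.
Proof. by move=> f g h; apply: endoP. Qed.
Fact endo_mulDr : right_distributive endo_mul endo_add.
Proof. by move=> f g h; apply: endoP => v /=; rewrite raddfD. Qed.
HB.instance Definition _ := GRing.Zmodule_isPzRing.Build (endo V)
  endo_mulA endo_mul1 endo_mulr1 endo_mulDl endo_mulDr.

Fact endo_scaleA a b f : endo_scale a (endo_scale b f) = endo_scale (a * b) f.
Proof. by apply: endoP => v /=; rewrite scalerA. Qed.
Fact endo_scale1 : left_id 1 endo_scale.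
Proof. by move=> f; apply: endoP => v /=; rewrite scale1r. Qed.
Fact endo_scaleDr : right_distributive endo_scale +%R.
Proof. by move=> a f g; apply: endoP => v /=; rewrite scalerDr. Qed.
Fact endo_scaleDl f : {morph endo_scale^~ f : a b / a + b}.
Proof. by move=> a b; apply: endoP => v /=; rewrite scalerDl. Qed.
HB.instance Definition _ := GRing.Zmodule_isLmodule.Build F (endo V)
  endo_scaleA endo_scale1 endo_scaleDr endo_scaleDl.

Lemma endo0E v : (0 : endo V) v = 0. Proof. by []. Qed.
Lemma endo1E v : (1 : endo V) v = v. Proof. by []. Qed.
Lemma endoDE f g v : (f + g) v = f v + g v. Proof. by []. Qed.
Lemma endoNE f v : (- f) v = - f v. Proof. by []. Qed.
Lemma endoBE f g v : (f - g) v = f v - g v. Proof. by []. Qed.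
Lemma endoME f g v : (f * g) v = f (g v). Proof. by []. Qed.
Lemma endoZE a f v : (a *: f) v = a *: f v. Proof. by []. Qed.

Lemma endo_linZ f a v : f (a *: v) = a *: f v. Proof. exact: linearZ. Qed.
Lemma endo_linsum f I (r : seq I) (P : pred I) (E : I -> V) :
  f (\sum_(i <- r | P i) E i) = \sum_(i <- r | P i) f (E i).
Proof. exact: linear_sum. Qed.

End EndoRing.

Section FiniteRank.
Variables (F : fieldType) (V : lmodType F).
Implicit Types (f w : endo V).

Definition finite_rank f : Prop := finite_dim (range f).

(* The subalgebra of End(V) spanned by the identity and the finite-rank
   endomorphisms. *)
Definition fscalar : set (endo V) :=
  [set f : endo V |
     exists (a : F) w, finite_rank w /\ f = a *: (1 : endo V) + w :> endo V].

Definition SPf : set (endo V) :=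
  [set u : endo V | bijective u /\ exists w, finite_rank w /\ u = 1 + w :> endo V].

(* [e] is a basis of a finite-dimensional subspace W containing Im(u - id) and
   [M] is the matrix of the endomorphism of W induced by [u]; by [is_fdet_uniq]
   and [is_fdet_exists], exactly one scalar satisfies this when u - id has
   finite rank. *)
Definition is_fdet (u : endo V) (d : F) : Prop :=
  exists n (e : 'I_n -> V) (M : 'M[F]_n),
    [/\ lfree e,
        range (u - 1) `<=` lspan e,
        forall i, u (e i) = \sum_(j < n) M j i *: e j
      & d = \det M].

Definition fdet (u : endo V) : F := xget 0 (is_fdet u).

Lemma lspan_sub n (e : 'I_n -> V) m (b : 'I_m -> V) :
  (forall i, lspan b (e i)) -> lspan e `<=` lspan b.
Proof.
move=> /choice[C eC] _ [c ->].
exists (fun k => \sum_i c i * C i k).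
under eq_bigr do rewrite eC scaler_sumr.
rewrite exchange_big; apply: eq_bigr => k _.
by rewrite scaler_suml; apply: eq_bigr => i _; rewrite scalerA.
Qed.

Lemma lspan_mem n (e : 'I_n -> V) i : lspan e (e i).
Proof.
exists (fun j => (j == i)%:R); rewrite (bigD1 i) //= eqxx scale1r big1 ?addr0 //.
by move=> j /negbTE->; rewrite scale0r.
Qed.

Lemma lspan_basis n (e : 'I_n -> V) :
  exists m (b : 'I_m -> V), lfree b /\ lspan b = lspan e.
Proof.
elim: n e => [|n IHn] e; first by exists 0%N, e; split=> // c _ [].
case: (EM (lfree e)) => [|/existsNP[c /not_implyP[c0 /existsNP[i /eqP ci]]]].
  by exists n.+1, e.
have [m [b [bf bs]]] := IHn (e \o lift i).
exists m, b; split=> //; rewrite bs; apply/seteqP; split; apply: lspan_sub => k.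
  exact: lspan_mem.
case: (unliftP i k) => [j|] ->; first exact: (lspan_mem (e \o lift i) j).
move: c0; rewrite (bigD1_ord i) //= => /eqP; rewrite addr_eq0 => /eqP c0.
exists (fun j => - ((c i)^-1 * c (lift i j))).
apply: (scalerI ci); rewrite c0 scaler_sumr -sumrN; apply: eq_bigr => j _.
by rewrite scalerA mulrN mulrA divff // mul1r scaleNr.
Qed.

Lemma lfree_inj n (e : 'I_n -> V) (c d : 'I_n -> F) : lfree e ->
  \sum_i c i *: e i = \sum_i d i *: e i -> c =1 d.
Proof.
move=> ef cd i; apply/eqP; rewrite -subr_eq0; apply/eqP.
apply: (ef (fun i => c i - d i)).
by under eq_bigr do rewrite scalerBl; rewrite sumrB cd subrr.
Qed.

Lemma det_1add_mulmxC (R : comNzRingType) m n (A : 'M[R]_(m, n)) (B : 'M[R]_(n, m)) :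
  \det (1%:M + A *m B) = \det (1%:M + B *m A).
Proof.
have /(congr1 determinant) : block_mx (1%:M + A *m B) (- A) 0 1%:M
      *m block_mx 1%:M 0 B 1%:M
    = block_mx 1%:M 0 B 1%:M *m block_mx 1%:M (- A) 0 (1%:M + B *m A).
  rewrite !mulmx_block !(mul0mx, mulmx0, mul1mx, mulmx1, addr0, add0r, mulNmx).
  by rewrite mulmxN addrK addrCA addNr addr0.
by rewrite !det_mulmx !det_ublock !det_lblock !det1 !(mul1r, mulr1).
Qed.

Lemma lsum_1add n (e : 'I_n -> V) (X : 'M[F]_n) i :
  \sum_j (1%:M + X) j i *: e j = e i + \sum_j X j i *: e j.
Proof.
under eq_bigr do rewrite !mxE scalerDl.
rewrite big_split; congr +%R.
by rewrite (bigD1 i) //= eqxx scale1r big1 ?addr0 // => k /negbTE->; rewrite scale0r.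
Qed.

Lemma det_coord_basis (u : endo V) n (e : 'I_n -> V) (M : 'M[F]_n)
    m (b : 'I_m -> V) (N : 'M[F]_m) :
  lfree e -> range (u - 1) `<=` lspan e ->
  (forall i, u (e i) = \sum_j M j i *: e j) ->
  lfree b -> (forall i, u (b i) = \sum_j N j i *: b j) ->
  lspan e `<=` lspan b -> \det M = \det N.
Proof.
move=> ef ue uM bf uN eb.
have /choice[E eE] : forall j, exists c : 'I_m -> F, e j = \sum_k c k *: b k.
  by move=> j; apply/eb/lspan_mem.
have /choice[P bP] : forall k, exists c : 'I_n -> F,
    (u - 1) (b k) = \sum_j c j *: e j.
  by move=> k; apply: ue; exists (b k).
pose A := \matrix_(j, k) P k j; pose B := \matrix_(k, j) E j k.
have -> : M = 1%:M + A *m B.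
  apply/matrixP => j i; apply: (@lfree_inj n e (M^~ i) ((1%:M + A *m B)^~ i) ef _ j).
  rewrite -uM lsum_1add.
  have -> : u (e i) = e i + (u - 1) (e i) by rewrite endoBE addrC subrK.
  congr +%R; rewrite [in LHS]eE endo_linsum.
  under [RHS]eq_bigr do rewrite !mxE scaler_suml.
  rewrite exchange_big; apply: eq_bigr => k _.
  rewrite endo_linZ bP scaler_sumr; apply: eq_bigr => l _.
  by rewrite !mxE scalerA mulrC.
have -> : N = 1%:M + B *m A.
  apply/matrixP => j i; apply: (@lfree_inj m b (N^~ i) ((1%:M + B *m A)^~ i) bf _ j).
  rewrite -uN lsum_1add.
  have -> : u (b i) = b i + (u - 1) (b i) by rewrite endoBE addrC subrK.
  congr +%R; rewrite bP.
  under [RHS]eq_bigr do rewrite !mxE scaler_suml.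
  rewrite exchange_big; apply: eq_bigr => k _.
  rewrite eE scaler_sumr; apply: eq_bigr => l _.
  by rewrite !mxE scalerA mulrC.
exact: det_1add_mulmxC.
Qed.

Lemma fdet_matrix (u : endo V) n (e : 'I_n -> V) :
  range (u - 1) `<=` lspan e ->
  exists M : 'M[F]_n, forall i, u (e i) = \sum_j M j i *: e j.
Proof.
move=> ue; have /choice[P eP] : forall k, exists c : 'I_n -> F,
    (u - 1) (e k) = \sum_j c j *: e j.
  by move=> k; apply: ue; exists (e k).
exists (1%:M + \matrix_(j, k) P k j) => i.
have -> : u (e i) = e i + (u - 1) (e i) by rewrite endoBE addrC subrK.
by rewrite lsum_1add eP; congr +%R; apply: eq_bigr => j _; rewrite mxE.
Qed.

Lemma is_fdet_uniq u d d' : is_fdet u d -> is_fdet u d' -> d = d'.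
Proof.
move=> [n [e [M [ef ue uM ->]]]] [m [e' [M' [ef' ue' uM' ->]]]].
pose g (i : 'I_(n + m)) := match fintype.split i with inl j => e j | inr k => e' k end.
have ge : lspan e `<=` lspan g.
  apply: lspan_sub => i; have := lspan_mem g (lshift m i).
  by rewrite {2}/g -[lshift _ _]/(unsplit (inl i)) unsplitK.
have ge' : lspan e' `<=` lspan g.
  apply: lspan_sub => i; have := lspan_mem g (rshift n i).
  by rewrite {2}/g -[rshift _ _]/(unsplit (inr i)) unsplitK.
have [r [b [bf bg]]] := lspan_basis g; rewrite -bg in ge ge'.
have [N uN] := fdet_matrix (subset_trans ue ge).
by rewrite (det_coord_basis ef ue uM bf uN ge) (det_coord_basis ef' ue' uM' bf uN ge').
Qed.

Lemma is_fdet_exists u : finite_rank (u - 1) -> exists d, is_fdet u d.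
Proof.
move=> [n [e ue]]; have [m [b [bf be]]] := lspan_basis e.
rewrite -be in ue; have [|M uM] := @fdet_matrix u _ b; first by rewrite ue.
by exists (\det M), m, b, M; split=> //; rewrite ue.
Qed.

Lemma fdetP u d : is_fdet u d -> fdet u = d.
Proof.
move=> ud; apply: is_fdet_uniq (ud); rewrite /fdet.
by case: xgetP => [x _|/(_ d)].
Qed.

Lemma SPf_is_fdet u : SPf u -> is_fdet u (fdet u).
Proof.
move=> [_ [w [wf uw]]]; have [|d ud] := @is_fdet_exists u.
  by rewrite uw addrC addKr.
by rewrite (fdetP ud).
Qed.

End FiniteRank.

(* Main.v *)
Require Import Defs.
From HB Require Import structures.
From mathcomp Require Import all_boot all_fingroup all_algebra.
From mathcomp Require Import boolp classical_sets.
From mathcomp Require Import ring.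

Set Implicit Arguments.
Unset Strict Implicit.
Unset Printing Implicit Defensive.

Import GRing.Theory.
Local Open Scope ring_scope.
Local Open Scope classical_set_scope.

(** Write u = 1 + w, where w has rank n, and let A be the matrix of u on the
range of w, so that det A = det u.  If p_1, ..., p_n is a basis of this range
and w s_i = p_i, then u acts on the p_i and s_i through the block matrix
[A, 1; 0, 1].  As V is infinite-dimensional, the s_i can be moved along ker w
so that all these vectors, together with one more vector fixed by u, are
linearly independent; linear forms dual to them (Zorn) turn a factorization of
the matrix of u into one of u ([SPf_normal_form], [extendM]).

The matrix [A, 1; 0, 1] is similar to the block companion matrix [companion2]
of t^2 - (1 + A) t + A.  Multiplying a block companion matrix on the left by
[1, 0; G, 1], which is unipotent of index 2, changes the coefficient of t
arbitrarily; multiplying it by the involution [1, 0; G, -1] does the same and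
also changes the sign of the constant coefficient.  So one factor is spent to
reach a companion matrix T of t^2 - Y t + C, where C is A or -A and Y can be
chosen at will, and T must then be a product of two involutions, or of two
unipotents of index 2.

Both follow from [graded_split]: T = (1 + a)(1 + b), where a and b have square
zero and some involution d satisfies d a = a = - a d and b d = b = - d b; then
also T = (d - a)(d - b), a product of two involutions.  Every unipotent matrix
has this form, since each of its cyclic blocks has ([nilpotent_graded_split]),
and so has the companion matrix of t^2 - Z t + 1 for every Z ([graded_split_companion2]).

Suppose that det C = 1.  If C is not scalar, it is similar to a product L R
with L and R unipotent ([nonscalar_LR]); then t^2 - (L + R) t + L R factors and
T is similar to the unipotent matrix [R, 1; 0, L] for Y = L + R.  If C is a
scalar c, with c^n = 1, it is the commutator of a diagonal matrix and a cyclic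
permutation matrix, and an explicit similarity carries T to the companion
matrix of some t^2 - Z t + 1 ([splittable_commutator]).

Suppose that det C = -1 and that -1 and 1 differ.  A similar choice of Y makes
T the direct sum of a graded split matrix and of the scalar -1
([split_off_sign]); if C is a scalar c and n is the least exponent with
c^n = -1, the eigenvalues of T are 1, -1 and the pairs c^j, c^-j.  Such a T is still a product of two involutions, but its
determinant forbids it to be a product of two unipotents.  This is where the
additional vector fixed by u is used: the involution which is the first factor
may change its sign, and the eigenvalue -1 of T is thereby completed to a
Jordan block of size 2, which is graded split ([split_off_sign_ext]).

Finally, involutions and unipotents of index 2 are stable under conjugation,
so that the order of the factors is immaterial ([prod3_swap12]). *)

(** * Graded splittings *)

(** The elements live in the corner ring of the idempotent e, in which d is an
involution.  When 2 is invertible, a and b map one eigenspace of d into the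
other, in opposite directions.  Working in corners makes direct sums an addition
of orthogonal terms. *)
Definition graded_split (R : pzRingType) (e N : R) : Prop :=
  exists a b d : R,
    [/\ a * a = 0 /\ b * b = 0, d * d = e /\ e * d = d,
        d * a = a /\ a * d = - a, b * d = b /\ d * b = - b
      & N = a + b + a * b].

Section Split.
Variable R : pzRingType.
Implicit Types e N a b d : R.

Lemma graded_split0 e : e * e = e -> graded_split e 0.
Proof.
move=> ee; exists 0, 0, e.
by rewrite !(mul0r, mulr0, oppr0, addr0).
Qed.

Lemma graded_split_corner e N : graded_split e N -> [/\ e * e = e, e * N = N & N * e = N].
Proof.
case=> a [b [d [_ [dd ed] [da ad] [bd db] ->]]].
have ea : e * a = a by rewrite -dd -mulrA da.
have ae : a * e = a by rewrite -dd mulrA ad mulNr ad opprK.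
have eb : e * b = b by rewrite -dd -mulrA db mulrN db opprK.
have be : b * e = b by rewrite -dd mulrA bd.
split; first by rewrite -{2}dd mulrA ed dd.
  by rewrite !mulrDr mulrA ea eb.
by rewrite !mulrDl -mulrA ae be.
Qed.

Lemma graded_splitD e e' N N' : e * e' = 0 -> e' * e = 0 ->
  graded_split e N -> graded_split e' N' -> graded_split (e + e') (N + N').
Proof.
move=> ee' e'e [a [b [d [[aa bb] [dd ed] [da ad] [bd db] ->]]]].
move=> [a' [b' [d' [[aa' bb'] [dd' ed'] [da' ad'] [bd' db'] ->]]]].
have de : d * e = d by rewrite -dd mulrA dd.
have de' : d' * e' = d' by rewrite -dd' mulrA dd'.
have ea : e * a = a by rewrite -dd -mulrA da.
have ae : a * e = a by rewrite -dd mulrA ad mulNr ad opprK.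
have eb : e * b = b by rewrite -dd -mulrA db mulrN db opprK.
have be : b * e = b by rewrite -dd mulrA bd.
have ea' : e' * a' = a' by rewrite -dd' -mulrA da'.
have ae' : a' * e' = a' by rewrite -dd' mulrA ad' mulNr ad' opprK.
have eb' : e' * b' = b' by rewrite -dd' -mulrA db' mulrN db' opprK.
have be' : b' * e' = b' by rewrite -dd' mulrA bd'.
have z x y : x * e = x -> e' * y = y -> x * y = 0.
  by move=> <- <-; rewrite -mulrA (mulrA e) ee' mul0r mulr0.
have z' x y : x * e' = x -> e * y = y -> x * y = 0.
  by move=> <- <-; rewrite -mulrA (mulrA e') e'e mul0r mulr0.
exists (a + a'), (b + b'), (d + d').
rewrite !mulrDl !mulrDr aa aa' bb bb' dd dd' da da' ad ad' bd bd' db db'.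
rewrite ed ed' ?(z _ _ ae ea') ?(z' _ _ ae' ea) ?(z _ _ be eb') ?(z' _ _ be' eb).
rewrite ?(z _ _ de ed') ?(z' _ _ de' ed) ?(z _ _ de ea') ?(z' _ _ de' ea).
rewrite ?(z _ _ ae ed') ?(z' _ _ ae' ed) ?(z _ _ be ed') ?(z' _ _ be' ed).
rewrite ?(z _ _ de eb') ?(z' _ _ de' eb) ?(z _ _ ae eb') ?(z' _ _ ae' eb).
have -> : e * d' = 0 by apply: z => //; rewrite -{2}dd mulrA ed dd.
have -> : e' * d = 0 by apply: z' => //; rewrite -{2}dd' mulrA ed' dd'.
by rewrite !(addr0, add0r) -!opprD; split=> //; rewrite addrACA (addrACA a).
Qed.

Lemma unipotent2_sqr0 a : a * a = 0 -> unipotent2 (1 + a).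
Proof. by move=> aa; rewrite /unipotent2 /= [1 + a]addrC addrK expr2. Qed.

Lemma graded_split_unipotent2 N : graded_split 1 N ->
  exists y z, [/\ unipotent2 y, unipotent2 z & 1 + N = y * z].
Proof.
case=> a [b [d [[aa bb] _ _ _ ->]]]; exists (1 + a), (1 + b).
split; try exact: unipotent2_sqr0.
by rewrite mulrDl mul1r mulrDr mulr1 -!addrA; congr (_ + _); rewrite addrCA.
Qed.

(** The grading turns the unipotents 1 + a and 1 + b into the involutions d - a
and d - b without changing the product, because a d = - a and d b = - b. *)
Lemma graded_split_involution e N : graded_split e N ->
  exists y z, [/\ y * y = e, z * z = e, e * y = y /\ y * e = y,
    e * z = z /\ z * e = z & e + N = y * z].
Proof.
move=> sN; have [ee _ _] := graded_split_corner sN; move: sN.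
case=> a [b [d [[aa bb] [dd ed] [da ad] [bd db] ->]]]; exists (d - a), (d - b).
have ea : e * a = a by rewrite -dd -mulrA da.
have ae : a * e = a by rewrite -dd mulrA ad mulNr ad opprK.
have eb : e * b = b by rewrite -dd -mulrA db mulrN db opprK.
have be : b * e = b by rewrite -dd mulrA bd.
have de : d * e = d by rewrite -dd mulrA dd.
rewrite !(mulrBl, mulrBr) aa bb dd da ad bd db ed de ea ae eb be.
split=> //; rewrite ?subr0 ?opprK ?subrK ?addrK //.
by rewrite opprD !opprK -!addrA; congr (_ + _); rewrite addrCA.
Qed.

End Split.

(** * Cyclic blocks *)

(** Conjugation by a rectangular pair with H G = 1 embeds a matrix ring in a
corner of a larger one; it covers both similarity (G invertible) and the
inclusion of a direct summand. *)
Section Lift.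
Variables (F : fieldType) (m n : nat) (G : 'M[F]_(n, m)) (H : 'M[F]_(m, n)).
Hypothesis HG : H *m G = 1%:M.

Lemma lift_mul (X Y : 'M[F]_m) :
  (G *m X *m H) * (G *m Y *m H) = G *m (X * Y) *m H.
Proof. by rewrite -!mulmxE !mulmxA -(mulmxA _ H G) HG mulmx1. Qed.

Lemma graded_split_lift (e N : 'M[F]_m) :
  graded_split e N -> graded_split (G *m e *m H) (G *m N *m H).
Proof.
case=> a [b [d [[aa bb] [dd ed] [da ad] [bd db] ->]]].
exists (G *m a *m H), (G *m b *m H), (G *m d *m H); rewrite !lift_mul.
rewrite aa bb dd ed da ad bd db !mulmxN !mulNmx mulmx0 mul0mx.
by rewrite !mulmxDr !mulmxDl.
Qed.

End Lift.

Section Cyclic.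
Variable F : fieldType.

Definition shift_if k (p : pred nat) : 'M[F]_k :=
  \matrix_(i, j) ((i == j.+1 :> nat) && p j)%:R.

Definition cols_of m k (X : nat -> 'cV[F]_m) : 'M[F]_(m, k) :=
  \matrix_(i, j) X j i 0.

Lemma cols_shift m k (X : nat -> 'cV[F]_m) p : X k = 0 ->
  cols_of k X *m shift_if k p
    = cols_of k (fun j => if p j then X j.+1 else 0).
Proof.
move=> Xk; apply/matrixP => i j; rewrite !mxE.
have [pj|pj] := ifP; last first.
  by rewrite mxE big1 // => l _; rewrite !mxE pj andbF mulr0.
have [ltjk|] := ltnP j.+1 k.
  rewrite (bigD1 (Ordinal ltjk)) //= !mxE eqxx pj mulr1 big1 ?addr0 // => l.
  by rewrite !mxE -val_eqE => /= /negbTE ->; rewrite mulr0.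
move=> lekj; have -> : j.+1 = k by apply/eqP; rewrite eqn_leq ltn_ord.
rewrite Xk mxE big1 // => l _.
by rewrite !mxE (ltn_eqF (leq_trans (ltn_ord l) lekj)) mulr0.
Qed.

Lemma shift_if_mul0 k (p q : pred nat) : (forall j, q j -> ~~ p j.+1) ->
  shift_if k p * shift_if k q = 0.
Proof.
move=> pq; apply/matrixP => i j; rewrite -mulmxE !mxE big1 // => l _.
rewrite !mxE; case: (l =P j.+1 :> nat) => [->|]; last by rewrite mulr0.
by case qj: (q j); rewrite ?mulr0 // (negbTE (pq _ qj)) andbF mul0r.
Qed.

Definition alt_sign k : 'M[F]_k := diag_mx (\row_j (-1) ^+ j).

(** Together a and b link every basis vector to the next one, so a + b + a b is
similar to every nilpotent cyclic block of its size. *)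
Lemma graded_split_cyclic k : let a := shift_if k odd in
  let b := shift_if k (predC odd) in graded_split 1 (a + b + a * b).
Proof.
move=> a b; exists a, b, (alt_sign k).
have dd : alt_sign k * alt_sign k = 1.
  rewrite -mulmxE mulmx_diag; apply/matrixP => i j; rewrite !mxE.
  by rewrite -expr2 sqrr_sign.
have hl p (i j : 'I_k) :
    (alt_sign k * shift_if k p) i j = (-1) ^+ i * shift_if k p i j.
  by rewrite -mulmxE mul_diag_mx !mxE.
have hr p (i j : 'I_k) :
    (shift_if k p * alt_sign k) i j = shift_if k p i j * (-1) ^+ j.
  by rewrite -mulmxE mul_mx_diag !mxE.
split=> //; split=> //.
- by apply: shift_if_mul0 => j /=; rewrite negbK.
- by apply: shift_if_mul0 => j /=; rewrite negbK.
- by rewrite mul1r.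
- apply/matrixP => i j; rewrite hl !mxE; case: eqP => [->|]; last by rewrite mulr0.
  by case oj: (odd j); rewrite /= ?mulr0 // mulr1 -signr_odd /= oj.
- apply/matrixP => i j; rewrite hr !mxE; case oj: (odd j).
    by rewrite -signr_odd oj /= mulrN1.
  by rewrite andbF mul0r oppr0.
- apply/matrixP => i j; rewrite hr !mxE /=; case oj: (odd j).
    by rewrite andbF mul0r.
  by rewrite -signr_odd oj mulr1.
- apply/matrixP => i j; rewrite hl !mxE /=; case: eqP => [->|]; last by rewrite mulr0 oppr0.
  by case oj: (odd j); rewrite /= ?mulr0 ?oppr0 // mulr1 -signr_odd /= oj.
Qed.

End Cyclic.

(** * Unipotent matrices *)

(** A nilpotent N of index k.+2 has a vector v and a linear form f with
f N^(k.+1) v = 1.  The cyclic space of v is then complemented by the common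
kernel of the forms f N^i, and the pairing between both is triangular with unit
diagonal.  The basis of the cyclic space is not the family N^j v, but a
multiple of it by powers of (1 + N)^-1, chosen to make N equal to
a + b + a b for the shifts a and b above. *)
Lemma cyclic_summand (F : fieldType) m (N e : 'M[F]_m) :
  e * e = e -> e * N = N -> N * e = N -> N != 0 -> (exists k, N ^+ k = 0) ->
  exists k (G : 'M[F]_(m, k)) (H : 'M[F]_(k, m)) (J : 'M[F]_k),
    [/\ H *m G = 1%:M, N *m G = G *m J & H *m N = J *m H] /\
    [/\ graded_split 1 J, e *m G = G, H *m e = H & N *m G != 0].
Proof.
move=> ee eN Ne N0 /cid[k1 Nk1].
have exk : exists k, N ^+ k == 0 by exists k1; apply/eqP.
case: (ex_minnP exk) => -[|[|k]] /eqP Nk mink.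
- by move: N0; rewrite -[N]mulr1 -[1](expr0 N) Nk mulr0 eqxx.
- by move: N0; rewrite -[N]expr1 Nk eqxx.
have eNX j : e * N ^+ j.+1 = N ^+ j.+1 by rewrite exprS mulrA eN.
have NXe j : N ^+ j.+1 * e = N ^+ j.+1 by rewrite exprSr -mulrA Ne.
have Nk0 : N ^+ k.+1 != 0 by apply/negP => /mink; rewrite ltnn.
have /matrix0Pn[i0 [j0 nij]] := Nk0.
pose f : 'rV[F]_m := delta_mx 0 i0 *m e.
pose v : 'cV[F]_m := ((N ^+ k.+1) i0 j0)^-1 *: (e *m delta_mx j0 0).
have fv : f *m N ^+ k.+1 *m v = 1%:M.
  rewrite /f /v -scalemxAr -(mulmxA _ e) mulmxE eNX mulmxA -(mulmxA _ _ e).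
  rewrite mulmxE NXe -rowE -colE; apply/matrixP => i j.
  by rewrite !ord1 !mxE mulVf.
have NXge j : (k.+2 <= j)%N -> N ^+ j = 0.
  by move=> lekj; rewrite -(subnKC lekj) exprD Nk mul0r.
(* P is the inverse of 1 + N *)
pose P : 'M[F]_m := \sum_(l < k.+2) (- N) ^+ l.
have cNP : GRing.comm N P.
  by apply: commr_sum => l _; apply: commrX; apply: commrN.
have ceP : GRing.comm e P.
  by apply: commr_sum => l _; apply: commrX; apply: commrN; rewrite /GRing.comm eN Ne.
have NP1 : (1 + N) * P = 1.
  have := subrX1 (- N) k.+2; rewrite exprNn Nk mulr0 sub0r -opprD [N + 1]addrC.
  by rewrite mulNr => /oppr_inj <-.
pose g l : 'cV[F]_m := N ^+ l *m P ^+ (uphalf l) *m v.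
have g0 : g 0%N = v by rewrite /g /= !expr0 !mul1mx.
have gge j : (k.+2 <= j)%N -> g j = 0 by move=> /NXge Nj; rewrite /g Nj !mul0mx.
have g_even j : ~~ odd j -> N *m g j = g j.+1 + g j.+2.
  move=> oj; rewrite /g /= !mulmxA -mulmxDl !mulmxE uphalf_half (negbTE oj).
  congr (_ *m _); rewrite add0n.
  transitivity (N ^+ j.+1 * ((1 + N) * P) * P ^+ j./2).
    by rewrite NP1 mulr1 exprS.
  by rewrite (mulrA (N ^+ j.+1)) mulrDr mulr1 -exprSr !mulrDl -!mulrA -!exprS.
have g_odd j : odd j -> N *m g j = g j.+1.
  by move=> oj; rewrite /g /= !mulmxA mulmxE -exprS uphalf_half oj.
have NPk u : N ^+ k.+1 * P ^+ u = N ^+ k.+1.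
  elim: u => [|u IHu]; first by rewrite mulr1.
  rewrite (exprSr P) mulrA IHu -[RHS]mulr1 -NP1 mulrA mulrDr mulr1 -exprSr Nk.
  by rewrite addr0.
pose G : 'M[F]_(m, k.+2) := cols_of k.+2 g.
pose Phi : 'M[F]_(k.+2, m) := \matrix_(i, j) (f *m N ^+ (k.+1 - i)) 0 j.
pose S := Phi *m G.
have SE (i j : 'I_k.+2) : S i j = (f *m N ^+ (k.+1 - i) *m g j) 0 0.
  by rewrite !mxE; apply: eq_bigr => l _; rewrite !mxE.
have Str : is_trig_mx S.
  apply/is_trig_mxP => i j ltij; rewrite SE /g !mulmxA -(mulmxA f) mulmxE -exprD.
  rewrite NXge ?mulmx0 ?mul0mx ?mxE //.
  apply: (leq_trans _ (leq_add (leqnn _) ltij)).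
  by rewrite addnS subnK // -ltnS ltn_ord.
have Sunit : S \in unitmx.
  rewrite unitmxE det_trig // big1 ?unitr1 // => i _.
  rewrite SE /g !mulmxA -(mulmxA f) mulmxE -exprD subnK -1?ltnS ?ltn_ord //.
  by rewrite -mulmxA -(mulmxA f) [X in f *m X]mulmxA mulmxE NPk mulmxA fv mxE.
pose H := invmx S *m Phi.
have HG : H *m G = 1%:M by rewrite /H -mulmxA mulVmx.
(* N acts on the forms f N^(k.+1 - i) by the shift J' *)
pose J' : 'M[F]_k.+2 := \matrix_(i, j) (i == j.+1 :> nat)%:R.
have PhiN : Phi *m N = J' *m Phi.
  apply/matrixP => i j; rewrite [RHS]mxE.
  have -> : (Phi *m N) i j = (f *m N ^+ (k.+2 - i)) 0 j.
    rewrite subSn -1?ltnS ?ltn_ord // exprSr -mulmxE mulmxA !mxE.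
    by apply: eq_bigr => l _; rewrite !mxE.
  case: i => -[|i] lti /=.
    rewrite Nk mulmx0 mxE big1 // => l _; by rewrite !mxE mul0r.
  rewrite (bigD1 (Ordinal (ltnW lti))) //= big1 => [|l].
    by rewrite !mxE eqxx mul1r addr0 subSS; apply: eq_bigr.
  by rewrite -val_eqE !mxE /= eqSS eq_sym => /negbTE->; rewrite mul0r.
pose a := shift_if F k.+2 odd; pose b := shift_if F k.+2 (predC odd).
pose J := a + b + a * b.
have NG : N *m G = G *m J.
  rewrite /J !mulmxDr -mulmxE mulmxA /a /b !cols_shift ?gge //=; last by case: ifP.
  apply/matrixP => i j.
  have -> : (N *m G) i j = (N *m g j) i 0.
    by rewrite !mxE; apply: eq_bigr => l _; rewrite !mxE.
  case oj: (odd j); first by rewrite g_odd // !mxE /= oj !mxE !addr0.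
  by rewrite g_even ?oj // !mxE /= oj !mxE add0r.
exists k.+2, G, H, J; split; split=> //.
- rewrite /H -mulmxA PhiN mulmxA; have : S *m J = J' *m S.
    by rewrite /S -mulmxA -NG mulmxA PhiN !mulmxA.
  move=> SJ; rewrite mulmxA; congr (_ *m _).
  rewrite -[LHS]mulmx1 -(mulmxV Sunit) mulmxA -(mulmxA (invmx S) J') -SJ.
  by rewrite mulmxA mulVmx // mul1mx.
- exact: graded_split_cyclic.
- apply/matrixP => i j; have -> : (e *m G) i j = (e *m g j) i 0.
    by rewrite !mxE; apply: eq_bigr => l _; rewrite !mxE.
  have -> : G i j = g j i 0 by rewrite mxE.
  congr (fun_of_matrix _ i 0).
  rewrite /g !mulmxA !mulmxE; case: (nat_of_ord j) => [|l].
    by rewrite !expr0 !mulr1 !mul1mx /v -scalemxAr mulmxA mulmxE ee.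
  by rewrite eNX.
- rewrite /H -mulmxA; congr (_ *m _).
  apply/matrixP => i j; have -> : (Phi *m e) i j = (f *m N ^+ (k.+1 - i) *m e) 0 j.
    by rewrite !mxE; apply: eq_bigr => l _; rewrite !mxE.
  have -> : Phi i j = (f *m N ^+ (k.+1 - i)) 0 j by rewrite mxE.
  congr (fun_of_matrix _ 0 j); rewrite -mulmxA mulmxE.
  case: (k.+1 - i)%N => [|l]; last by rewrite NXe.
  by rewrite expr0 mul1r mulmx1 /f -mulmxA mulmxE ee.
- apply/eqP => NG0; have Nv : N *m v = 0.
    have -> : N *m v = N *m G *m delta_mx 0 (0 : 'I_1).
      by rewrite -mulmxA -g0 -colE; congr (_ *m _); apply/matrixP => i j; rewrite !mxE !ord1.
    by rewrite NG0 mul0mx.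
  move: fv; rewrite exprSr -mulmxE mulmxA -mulmxA Nv mulmx0.
  by move=> /matrixP/(_ 0 0)/eqP; rewrite !mxE eq_sym oner_eq0.
Qed.

Lemma nilpotent_graded_split (F : fieldType) m (N e : 'M[F]_m) :
  e * e = e -> e * N = N -> N * e = N -> (exists k, N ^+ k = 0) -> graded_split e N.
Proof.
have [r] := ubnP (\rank N); elim: r N e => // r IHr N e ltNr ee eN Ne Nnil.
have [->|N0] := eqVneq N 0; first exact: graded_split0.
have [k [G [H [J [[HG NG HN] [Jsp eG He NG0]]]]]] := cyclic_summand ee eN Ne N0 Nnil.
pose E := G *m H.
have EE : E * E = E by rewrite -mulmxE /E !mulmxA -(mulmxA G H) HG mulmx1.
have eE : e * E = E by rewrite -mulmxE /E mulmxA eG.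
have Ee : E * e = E by rewrite -mulmxE /E -mulmxA He.
have NE : N * E = G *m J *m H by rewrite -mulmxE /E mulmxA NG.
have EN : E * N = G *m J *m H by rewrite -mulmxE /E -mulmxA HN mulmxA.
have -> : e = E + (e - E) by rewrite addrC subrK.
have -> : N = E * N + (N - E * N) by rewrite addrC subrK.
apply: graded_splitD; rewrite ?mulrBr ?mulrBl ?EE ?eE ?Ee ?subrr //.
  by rewrite EN; have := graded_split_lift HG Jsp; rewrite mulmx1.
apply: IHr.
- have sub : (N - E * N <= N)%MS.
    by rewrite -[X in (X - _ <= _)%MS]mul1r -mulrBl -mulmxE submxMl.
  apply: (@leq_trans (\rank N)); last by rewrite -ltnS.
  rewrite ltn_neqAle (mxrankS sub) andbT.
  rewrite (mxrank_leqif_sup sub); apply: contra NG0 => /submxP[X NX].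
  have NE0 : N * E = 0.
    have N1E : (N - E * N) * E = 0.
      by rewrite mulrBl -mulrA NE -EN mulrA EE subrr.
    by rewrite {1}NX -mulmxE -mulmxA mulmxE N1E mulr0.
  by apply/eqP; rewrite NG -[J]mulmx1 -HG !mulmxA -NE NE0 mul0mx.
- by rewrite mulrBr !mulrBl ee eE Ee EE subrr subr0.
- by rewrite mulrBr !mulrBl eN (mulrA e) eE (mulrA E) EE subrr subr0.
- by rewrite mulrBl !mulrBr Ne -(mulrA E) Ne NE -(mulrA E) NE -EN mulrA EE subrr subr0.
- have [l Nl] := Nnil; exists l.+1.
  have -> : N - E * N = (1 - E) * N by rewrite mulrBl mul1r.
  rewrite exprMn_comm.
    by rewrite (exprS N) Nl mulr0 mulr0.
  by apply: commr_sym; apply: commrB; [exact: commr1 | rewrite /GRing.comm NE EN].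
Qed.

(** * Triangular factorization of nonscalar matrices *)

Section LR.
Variable F : fieldType.

Definition nilpotentmx n (N : 'M[F]_n) : Prop := exists k, N ^+ k = 0.

Lemma nilpotentmx0 n : nilpotentmx (0 : 'M[F]_n).
Proof. by exists 1%N; rewrite expr1. Qed.

Lemma nilpotentmx_block m n (X : 'M[F]_m) Y (Z : 'M[F]_n) :
  nilpotentmx X -> nilpotentmx Z -> nilpotentmx (block_mx X Y 0 Z).
Proof.
move=> [k Xk] [l Zl].
have pow i : exists Y', block_mx X Y 0 Z ^+ i = block_mx (X ^+ i) Y' 0 (Z ^+ i).
  elim: i => [|i [Y' IHi]]; first by exists 0; rewrite !expr0 -scalar_mx_block.
  exists (X *m Y' + Y *m Z ^+ i).
  by rewrite exprS IHi -mulmxE mulmx_block !mul0mx !mulmx0 !addr0 add0r !mulmxE -!exprS.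
have [Yk Ek] := pow k; have [Yl El] := pow l.
exists (k + l)%N; rewrite exprD Ek El Xk Zl -mulmxE mulmx_block.
by rewrite !mul0mx !mulmx0 !addr0 block_mx0.
Qed.

Lemma nilpotentmx_tr n (N : 'M[F]_n) : nilpotentmx N -> nilpotentmx N^T.
Proof.
move=> [k Nk]; exists k; rewrite -[RHS](trmx0 F n n) -Nk.
elim: k {Nk} => [|k IHk]; first by rewrite !expr0 trmx1.
by rewrite exprS exprSr IHk -mulmxE trmx_mul.
Qed.

Lemma nilpotentmx_blockl m n (X : 'M[F]_m) Y (Z : 'M[F]_n) :
  nilpotentmx X -> nilpotentmx Z -> nilpotentmx (block_mx X 0 Y Z).
Proof.
move=> /nilpotentmx_tr Xn /nilpotentmx_tr Zn; rewrite -[block_mx _ _ _ _]trmxK.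
by apply: nilpotentmx_tr; rewrite tr_block_mx trmx0; apply: nilpotentmx_block.
Qed.

Lemma block_mx1 m n : block_mx 1%:M 0 0 1%:M = 1 :> 'M[F]_(m + n).
Proof. by rewrite -scalar_mx_block. Qed.

Definition simmx n (A B : 'M[F]_n) : Prop :=
  exists2 g, g \in unitmx & g *m A = B *m g.

Lemma simmx_trans n (A B C : 'M[F]_n) : simmx A B -> simmx B C -> simmx A C.
Proof.
move=> [g gu gA] [h hu hB]; exists (h *m g); first by rewrite unitmx_mul hu gu.
by rewrite -mulmxA gA !mulmxA hB.
Qed.

Lemma unit_block1l m n (y : 'M[F]_(n, m)) : block_mx 1%:M 0 y 1%:M \in unitmx.
Proof. by rewrite unitmxE det_lblock !det1 mulr1 unitr1. Qed.

Lemma unit_block1r m n (y : 'M[F]_(m, n)) : block_mx 1%:M y 0 1%:M \in unitmx.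
Proof. by rewrite unitmxE det_ublock !det1 mulr1 unitr1. Qed.

Lemma nonscalar_ursubmx n (C : 'M[F]_(1 + n)) : ~~ is_scalar_mx C ->
  exists2 B, simmx C B & ursubmx B != 0.
Proof.
move=> Cns.
pose z : 'I_(1 + n) := lshift n 0.
have zE (k : 'I_1) : lshift n k = z by rewrite ord1.
have [[i [j [ij Cij]]]|Cd] := pselect (exists i j, i != j /\ C i j != 0).
  pose t := tperm z i.
  exists (row_perm t (col_perm t C)).
    exists (perm_mx t); first exact: unitmx_perm.
    by rewrite row_permE col_permE -!mulmxA -perm_mxM mulVg perm_mx1 mulmx1.
  apply/matrix0Pn; have: t j != z.
    by rewrite -(tpermR z i) (inj_eq perm_inj) eq_sym.
  case: (split_ordP (t j)) => k tj; first by rewrite tj zE eqxx.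
  by move=> _; exists 0, k; rewrite !mxE -tj tpermK zE tpermL.
have {}Cd i j : i != j -> C i j = 0.
  by move=> ij; apply: contrapT => /eqP Cij; apply: Cd; exists i, j.
have [[k Ck]|Ce] := pselect (exists k, C (rshift 1 k) (rshift 1 k) != C z z); last first.
  case/is_scalar_mxP: Cns; exists (C z z); apply/matrixP => i j; rewrite mxE.
  have [->|/Cd//] := eqVneq i j.
  rewrite mulr1n; case: (split_ordP j) => l ->; first by rewrite zE.
  by apply: contrapT => /eqP Cl; apply: Ce; exists l.
pose x : 'M[F]_(1, n) := delta_mx 0 k.
exists (block_mx 1%:M x 0 1%:M *m C *m block_mx 1%:M (- x) 0 1%:M).
  exists (block_mx 1%:M x 0 1%:M); first exact: unit_block1r.
  rewrite -[RHS]mulmxA mulmx_block !mul0mx !mulmx0 !mul1mx !mulmx1 !addr0 !add0r.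
  by rewrite subrr -scalar_mx_block mulmx1.
rewrite -[C]submxK !mulmx_block block_mxKur.
apply/matrix0Pn; exists 0, k.
rewrite !mul1mx !mulmx1 /x -!rowE.
have -> : ursubmx C = 0.
  by apply/matrixP => i j; rewrite !mxE Cd // eq_lrshift.
have -> : dlsubmx C = 0.
  by apply/matrixP => i j; rewrite !mxE Cd // eq_rlshift.
rewrite row0 addr0 add0r mulmxN !mxE big_ord1 !mxE !eqxx mulr1 addrC subr_eq0.
by rewrite zE.
Qed.

(** Conjugation by [1, 0; y, 1] subtracts x y from the corner entry, where x is
the rest of the first row; this reaches the value 1 as soon as x is nonzero. *)
Lemma nonscalar_corner1 n (C : 'M[F]_(1 + n)) : ~~ is_scalar_mx C ->
  exists x l D, simmx C (block_mx 1%:M x l D) /\ x != 0.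
Proof.
move=> /nonscalar_ursubmx[B CB r0].
have /matrix0Pn[i [k rk]] := r0.
pose r := ursubmx B.
pose y : 'M[F]_(n, 1) := (r i k)^-1 *: (delta_mx k 0 *m (ulsubmx B - 1%:M)).
have ry : r *m y = ulsubmx B - 1%:M.
  rewrite /y -scalemxAr mulmxA -colE; apply/matrixP => a b.
  rewrite ord1 !mxE big_ord1 !mxE !ord1 (_ : B _ _ = r i k); last by rewrite !mxE ord1.
  by rewrite mulrA mulVf ?mul1r.
exists r, (y *m ulsubmx B + dlsubmx B - (y *m r + drsubmx B) *m y), (y *m r + drsubmx B).
split=> //; apply: (simmx_trans CB).
exists (block_mx 1%:M 0 y 1%:M); first exact: unit_block1l.
rewrite -[B in LHS]submxK !mulmx_block !mul0mx !mulmx0 !mul1mx !mulmx1 !addr0 !add0r.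
by rewrite ry subrK [1%:M + _]addrC subrK.
Qed.

Lemma row_ker_nz n (r : 'rV[F]_n.+2) : exists2 y : 'cV_n.+2, r *m y = 0 & y != 0.
Proof.
exists (nz_row (kermx r^T))^T.
  apply: trmx_inj; rewrite trmx_mul trmxK trmx0; apply/sub_kermxP.
  exact: nz_row_sub.
rewrite trmx_eq0 nz_row_eq0 -mxrank_eq0 mxrank_ker.
by rewrite subn_eq0 -ltnNge (leq_ltn_trans (rank_leq_col _)).
Qed.

(** The Schur complement D - l x is the matrix on which an induction proceeds,
so it has to stay nonscalar.  If it is a scalar k, conjugating by [1, 0; y, 1]
with x y = 0 leaves the first row alone and changes the complement into
k (1 + y x), which is not scalar. *)
Lemma nonscalar_corner n (C : 'M[F]_(1 + n)) : ~~ is_scalar_mx C -> \det C != 0 ->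
  exists x l D, [/\ simmx C (block_mx 1%:M x l D), \det (D - l *m x) = \det C
    & (1 < n)%N -> ~~ is_scalar_mx (D - l *m x)].
Proof.
move=> Cns dC.
have simdet x l (D : 'M_n) : simmx C (block_mx 1%:M x l D) -> \det (D - l *m x) = \det C.
  case=> g gu /(congr1 determinant); rewrite !det_mulmx mulrC.
  move: gu; rewrite unitmxE unitfE => gu /(mulIf gu) ->.
  have -> : block_mx 1%:M x l D =
      block_mx 1%:M 0 l 1%:M *m block_mx 1%:M x 0 (D - l *m x).
    by rewrite mulmx_block !mul0mx !mul1mx !mulmx1 !addr0 addrC subrK.
  by rewrite det_mulmx det_lblock det_ublock !det1 !mul1r.
have [x [l [D [CB x0]]]] := nonscalar_corner1 Cns.
have dS := simdet _ _ _ CB.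
have [/is_scalar_mxP[k Sk]|Sns] := boolP (is_scalar_mx (D - l *m x)); last first.
  by exists x, l, D; split.
case: n => [|[|n]] in C Cns dC simdet x l D CB x0 dS Sk *; try by exists x, l, D.
have [y xy y0] := row_ker_nz x.
have DE : D = k%:M + l *m x by rewrite -Sk subrK.
have kn0 : k != 0.
  by apply: contra dC => /eqP k0; rewrite -dS Sk k0 det_scalar exprS mul0r.
pose l' := y + l - (y *m x + D) *m y.
have CB' : simmx C (block_mx 1%:M x l' (y *m x + D)).
  apply: (simmx_trans CB); exists (block_mx 1%:M 0 y 1%:M); first exact: unit_block1l.
  rewrite !mulmx_block !mul0mx !mulmx0 !mul1mx !mulmx1 !addr0 !add0r xy addr0.
  by rewrite /l' subrK.
exists x, l', (y *m x + D); split=> //; first exact: simdet.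
move=> _; apply/negP => /is_scalar_mxP[c].
have -> : y *m x + D - l' *m x = k%:M + k *: (y *m x).
  have -> : l' = y + l - k *: y.
    rewrite /l' DE !mulmxDl -!mulmxA xy !mulmx0 addr0 add0r.
    by rewrite mul_scalar_mx.
  rewrite DE !(mulmxDl, mulNmx) -scalemxAl.
  by apply/matrixP => i j; rewrite !mxE; ring.
move=> kc; have yxE : y *m x = (k^-1 * (c - k))%:M.
  apply: (scalerI kn0); rewrite scale_scalar_mx mulrA mulfV // mul1r.
  by rewrite raddfB /= -kc addrC addKr.
have: (y *m x) *m y = 0 by rewrite -mulmxA xy mulmx0.
rewrite {1}yxE mul_scalar_mx => /eqP; rewrite scaler_eq0 (negbTE y0) orbF => /eqP ck.
move: yxE; rewrite ck raddf0 => yx0.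
have /matrix0Pn[i [j yij]] := y0; have /matrix0Pn[i' [j' xij]] := x0.
move: yx0 => /matrixP/(_ i j'); rewrite !mxE big_ord1.
rewrite ord1 in yij; rewrite ord1 in xij.
by move=> /eqP; rewrite mulf_eq0 (negbTE yij) (negbTE xij).
Qed.

(** Up to similarity, R is triangular with diagonal 1, ..., 1, d.  For d != 1
the eigenvalue d is recorded through its left and right eigenvectors f and b,
and R is unipotent on the complement of the projector b f. *)
Definition nearly_unipotent n (d : F) (R : 'M[F]_n) : Prop :=
  if d == 1 then nilpotentmx (R - 1) else
  exists (b : 'cV_n) (f : 'rV_n),
    [/\ R *m b = d *: b, f *m R = d *: f, f *m b = 1%:M
      & nilpotentmx ((R - 1) * (1 - b *m f))].

Lemma nearly_unipotent_block n d x (R : 'M[F]_n) :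
  nearly_unipotent d R -> nearly_unipotent d (block_mx (1%:M : 'M_1) x 0 R).
Proof.
have subb : block_mx (1%:M : 'M_1) x 0 R - 1 = block_mx 0 x 0 (R - 1).
  by rewrite -block_mx1 opp_block_mx add_block_mx !subr0 subrr.
rewrite /nearly_unipotent; case: (d =P 1) => [_|/eqP d1].
  by rewrite subb; apply: nilpotentmx_block; exact: nilpotentmx0.
have d10 : d - 1 != 0 by rewrite subr_eq0.
case=> b [f [Rb fR fb nil]].
pose c := (d - 1)^-1 *: (x *m b).
exists (col_mx c b), (row_mx 0 f); split.
- rewrite mul_block_col mul0mx add0r Rb mul1mx scale_col_mx; congr col_mx.
  have -> : x *m b = (d - 1) *: c by rewrite /c scalerA mulfV // scale1r.
  by rewrite scalerBl scale1r addrC subrK.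
- by rewrite mul_row_block !mul0mx mulmx0 !add0r fR scale_row_mx scaler0.
- by rewrite mul_row_col mul0mx add0r.
rewrite subb mul_col_row !mulmx0 -[X in _ * (X - _)]block_mx1.
rewrite opp_block_mx add_block_mx !subr0 sub0r -mulmxE mulmx_block.
rewrite !mul0mx !mulmx0 !addr0 !add0r.
by apply: nilpotentmx_block; rewrite ?mulmxE //; exact: nilpotentmx0.
Qed.

(** Sourour's factorization: after a change of basis C has an LU factorization
with unipotent L and prescribed diagonal of the upper factor. *)
Lemma nonscalar_LR n (C : 'M[F]_(1 + n)) d : (0 < n)%N -> ~~ is_scalar_mx C ->
  \det C = d -> d != 0 ->
  exists L R, [/\ simmx C (L *m R), nilpotentmx (L - 1) & nearly_unipotent d R].
Proof.
move=> n0 Cns dC d0; have {n0 Cns} : (0 < n)%N -> ~~ is_scalar_mx C by [].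
elim: n C dC => [|n IHn] C dC Cns.
  exists 1%:M, C; split.
  - by exists 1%:M; [exact: unitmx1 | rewrite !mul1mx mulmx1].
  - by rewrite (_ : _ - _ = 0); [exact: nilpotentmx0 | exact: subrr].
  have CE : C = d%:M.
    by rewrite -dC det_mx11; apply/matrixP => i j; rewrite !ord1 !mxE eqxx mulr1n.
  rewrite CE /nearly_unipotent; case: (d =P 1) => [->|_].
    by rewrite (_ : _ - _ = 0); [exact: nilpotentmx0 | exact: subrr].
  exists 1%:M, 1%:M; rewrite !mulmx1 mul1mx scalemx1; split=> //.
  by rewrite (_ : 1 - _ = 0) ?mulr0; [exact: nilpotentmx0 | exact: subrr].
have [|x [l [D [CB dS Sns]]]] := nonscalar_corner (Cns isT); first by rewrite dC.
have [|//|L [R [[h hu hS] Ln Rn]]] := IHn (D - l *m x); first by rewrite dS.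
exists (block_mx 1%:M 0 (h *m l) L), (block_mx 1%:M (x *m invmx h) 0 R).
split; last exact: nearly_unipotent_block.
  apply: (simmx_trans CB); exists (block_mx 1%:M 0 0 h).
    by rewrite unitmxE det_ublock det1 mul1r -unitmxE.
  rewrite !mulmx_block !mul0mx !mulmx0 !mul1mx !mulmx1 !addr0 !add0r mulmxKV //.
  congr block_mx; rewrite mulmxDl -hS mulmxA -!mulmxA mulVmx // mulmx1.
  by rewrite mulmxBr addrC subrK.
rewrite -block_mx1 opp_block_mx add_block_mx !subr0 subrr.
by apply: nilpotentmx_blockl => //; exact: nilpotentmx0.
Qed.

End LR.

(** * Products of three factors *)

Section Prod3.
Variable R : pzRingType.
Implicit Types (X Y Z : set R) (x y z u : R).

Definition conj_closed X : Prop :=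
  forall g h x, h * g = 1 -> g * h = 1 -> X x -> X (g * x * h).

Definition inv_set X : Prop :=
  forall x, X x -> exists x', x * x' = 1 /\ x' * x = 1.

Lemma conj_mul g h x y : h * g = 1 ->
  (g * x * h) * (g * y * h) = g * (x * y) * h.
Proof. by move=> hg; rewrite !mulrA -(mulrA _ h g) hg mulr1. Qed.

Lemma involution_conj : conj_closed (@involution R).
Proof.
move=> g h x; rewrite /involution /= !expr2 => hg gh xx.
by rewrite conj_mul // xx mulr1.
Qed.

Lemma unipotent2_conj : conj_closed (@unipotent2 R).
Proof.
move=> g h x; rewrite /unipotent2 /= !expr2 => hg gh xx.
have -> : g * x * h - 1 = g * (x - 1) * h by rewrite mulrBr mulrBl mulr1 gh.
by rewrite conj_mul // xx mulr0 mul0r.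
Qed.

Lemma involution_inv : inv_set (@involution R).
Proof. by move=> x; rewrite /involution /= expr2 => xx; exists x. Qed.

Lemma unipotent2_inv : inv_set (@unipotent2 R).
Proof.
move=> x; rewrite /unipotent2 /= expr2; set n := x - 1 => nn.
have -> : x = 1 + n by rewrite /n addrC subrK.
exists (1 - n); split.
  by rewrite mulrDl mul1r mulrBr mulr1 nn subr0 subrK.
by rewrite mulrBl mul1r mulrDr mulr1 nn addr0 addrK.
Qed.

Lemma prod3_conj X Y Z g h u :
  conj_closed X -> conj_closed Y -> conj_closed Z ->
  h * g = 1 -> g * h = 1 -> prod3 X Y Z u -> prod3 X Y Z (g * u * h).
Proof.
move=> cX cY cZ hg gh [x [y [z [Xx Yy Zz ->]]]].
exists (g * x * h), (g * y * h), (g * z * h).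
by split; [exact: cX | exact: cY | exact: cZ | rewrite !conj_mul].
Qed.

(** x y z = y (y^-1 x y) z *)
Lemma prod3_swap12 X Y Z u : conj_closed X -> inv_set Y ->
  prod3 X Y Z u -> prod3 Y X Z u.
Proof.
move=> cX iY [x [y [z [Xx Yy Zz ->]]]]; have [y' [yy' y'y]] := iY y Yy.
exists y, (y' * x * y), z; split=> //; first exact: cX.
by rewrite !mulrA yy' mul1r.
Qed.

Lemma prod3_swap23 X Y Z u : conj_closed Y -> inv_set Z ->
  prod3 X Y Z u -> prod3 X Z Y u.
Proof.
move=> cY iZ [x [y [z [Xx Yy Zz ->]]]]; have [z' [zz' z'z]] := iZ z Zz.
exists x, z, (z' * y * z); split=> //; first exact: cY.
by rewrite !mulrA -(mulrA x z) zz' mulr1.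
Qed.

End Prod3.

(** * Block companion matrices *)

Section Companion.
Variable F : fieldType.

(** The block companion matrix of t^2 - Y t + C. *)
Definition companion2 n (C Y : 'M[F]_n) : 'M[F]_(n + n) := block_mx 0 1%:M (- C) Y.

(** T acts as -1 on a line, with eigenvectors v (right) and f (left), and is
graded split on the complement.  The row h is meant to be appended to T: the
vector q is the change of basis which brings the extended matrix
[T, 0; h, -1] to the direct sum of that complement and a Jordan block of size
2 for the eigenvalue -1. *)
Definition split_off_sign m (T : 'M[F]_m) (h : 'rV_m) : Prop :=
  exists (v : 'cV_m) (f q : 'rV_m),
    [/\ T *m v = - v, f *m T = - f, f *m v = 1%:M & h *m v = 1%:M] /\
    [/\ q *m (T + 1) = f - h, q *m v = 0
      & graded_split (1 - v *m f) ((T - 1) * (1 - v *m f))].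

(** [splittable] is the property wanted of matrices of determinant 1, and
[nearly_splittable] its counterpart for the determinant -1; the row appended in
the latter is zero on the first block because it has to be cancelled by the
third row of an involution [1, 0, 0; G, -1, 0; h, 0, -1]. *)
Definition splittable n (C : 'M[F]_n) : Prop := exists Y, graded_split 1 (companion2 C Y - 1).

Definition nearly_splittable n (C : 'M[F]_n) : Prop :=
  exists Y (h : 'rV_n), split_off_sign (companion2 C Y) (row_mx 0 h).

Lemma graded_split_conj m (g e N : 'M[F]_m) : g \in unitmx ->
  graded_split e N -> graded_split (invmx g *m e *m g) (invmx g *m N *m g).
Proof. by move=> gu; apply: graded_split_lift; rewrite mulmxV. Qed.

Lemma graded_split_sim m (g T T' : 'M[F]_m) : g \in unitmx -> g *m T = T' *m g ->
  graded_split 1 (T' - 1) -> graded_split 1 (T - 1).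
Proof.
move=> gu gT /(graded_split_conj gu); rewrite mulmx1 mulVmx // => s.
have -> : T - 1 = invmx g *m (T' - 1) *m g => //.
by rewrite mulmxBr mulmxBl mulmx1 mulVmx // -mulmxA -gT mulKmx.
Qed.

Lemma split_off_sign_sim m (g T T' : 'M[F]_m) h : g \in unitmx -> g *m T = T' *m g ->
  split_off_sign T' h -> split_off_sign T (h *m g).
Proof.
move=> gu gT [v [f [q [[Tv fT fv hv] [qT qv s]]]]].
have gV : T *m invmx g = invmx g *m T'.
  by rewrite -[T](mulKmx gu) gT -!mulmxA mulmxV // mulmx1.
exists (invmx g *m v), (f *m g), (q *m g); split; split.
- by rewrite mulmxA gV -mulmxA Tv mulmxN.
- by rewrite -mulmxA gT mulmxA fT mulNmx.
- by rewrite mulmxA mulmxK.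
- by rewrite mulmxA mulmxK.
- have gT1 : g *m (T + 1) = (T' + 1) *m g by rewrite mulmxDr mulmxDl gT mul1mx mulmx1.
  by rewrite -mulmxA gT1 mulmxA qT mulmxBl.
- by rewrite mulmxA mulmxK.
have TE : T = invmx g *m T' *m g by rewrite -mulmxA -gT mulKmx.
have E1 : 1 - invmx g *m v *m (f *m g) = invmx g *m (1 - v *m f) *m g.
  by rewrite mulmxBr mulmxBl mulmx1 mulVmx // !mulmxA.
have E2 : T - 1 = invmx g *m (T' - 1) *m g.
  by rewrite mulmxBr mulmxBl mulmx1 mulVmx // -TE.
by rewrite E1 E2 lift_mul ?mulmxV //; apply: graded_split_conj.
Qed.

Lemma unit_block_diag m n (g : 'M[F]_m) (h : 'M[F]_n) : g \in unitmx ->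
  h \in unitmx -> block_mx g 0 0 h \in unitmx.
Proof. by rewrite !unitmxE det_ublock unitrM => -> ->. Qed.

Lemma companion2_sim n (g C C' Y' : 'M[F]_n) : g \in unitmx -> g *m C = C' *m g ->
  block_mx g 0 0 g *m companion2 C (invmx g *m Y' *m g) = companion2 C' Y' *m block_mx g 0 0 g.
Proof.
move=> gu gC; rewrite /companion2 !mulmx_block !mul0mx !mulmx0 !add0r !addr0.
by rewrite mulmx1 mul1mx mulmxN mulNmx gC !mulmxA mulmxV // mul1mx.
Qed.

Lemma splittable_sim n (C C' : 'M[F]_n) : simmx C C' -> splittable C' -> splittable C.
Proof.
move=> [g gu gC] [Y sY]; exists (invmx g *m Y *m g).
exact: (graded_split_sim (unit_block_diag gu gu) (companion2_sim _ gu gC)).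
Qed.

Lemma nearly_splittable_sim n (C C' : 'M[F]_n) :
  simmx C C' -> nearly_splittable C' -> nearly_splittable C.
Proof.
move=> [g gu gC] [Y [h sY]]; exists (invmx g *m Y *m g), (h *m g).
have := split_off_sign_sim (unit_block_diag gu gu) (companion2_sim Y gu gC) sY.
by rewrite mul_row_block !mul0mx mulmx0 !add0r.
Qed.

(** The factorization t^2 - (L + R) t + L R = (t - L) (t - R) makes the companion
matrix block triangular, up to similarity. *)
Lemma companion2_triangular n (L R : 'M[F]_n) :
  block_mx 1%:M 0 (- R) 1%:M *m companion2 (L *m R) (L + R)
    = block_mx R 1%:M 0 L *m block_mx 1%:M 0 (- R) 1%:M.
Proof.
rewrite /companion2 !mulmx_block !mul0mx !mulmx0 !mul1mx !mulmx1 !add0r.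
by rewrite subrr mulmxN addr0 addrC addrK.
Qed.

Lemma nilpotentmx_graded_split m (N : 'M[F]_m) : nilpotentmx N -> graded_split 1 N.
Proof. by move=> Nn; apply: nilpotent_graded_split; rewrite ?mulr1 ?mul1r. Qed.

Lemma splittable_LR n (L R : 'M[F]_n) :
  nilpotentmx (L - 1) -> nilpotentmx (R - 1) -> splittable (L *m R).
Proof.
move=> Ln Rn; exists (L + R).
apply: (graded_split_sim (unit_block1l _) (companion2_triangular L R)).
apply: nilpotentmx_graded_split; rewrite -block_mx1 opp_block_mx add_block_mx !subr0.
exact: nilpotentmx_block.
Qed.

Lemma nilpotentmx_unit n (N : 'M[F]_n) (c : F) : c != 0 -> nilpotentmx N -> c%:M + N \in unitmx.
Proof.
move=> c0 [k Nk]; pose M := N * (- c^-1)%:M.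
have Mk : M ^+ k = 0.
  rewrite exprMn_comm ?Nk ?mul0r //.
  by rewrite /GRing.comm -!mulmxE scalar_mxC.
have := subrX1 M k; rewrite Mk sub0r => /eqP; rewrite eqr_oppLR -mulNr opprB => /eqP e1.
have -> : c%:M + N = c *: (1 - M).
  rewrite scalerBr /M -mulmxE scalar_mxC mul_scalar_mx scalerA mulrN mulfV //.
  by rewrite scaleN1r opprK scalemx1.
rewrite unitmxZ ?unitfE //.
by move: e1; rewrite -mulmxE => /esym/mulmx1_unit[].
Qed.

(** The eigenvectors of R for -1 extend to eigenvectors of the block triangular
matrix [R, 1; 0, L], because L + 1 = 2 + (L - 1) is invertible. *)
Lemma nearly_splittable_LR n (L R : 'M[F]_n) : (-1 : F) != 1 ->
  nilpotentmx (L - 1) -> nearly_unipotent (-1) R -> nearly_splittable (L *m R).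
Proof.
move=> n2 Ln; rewrite /nearly_unipotent (negbTE n2) => -[b [f [Rb fR fb Rn]]].
rewrite !scaleN1r in Rb fR.
have L1u : L + 1 \in unitmx.
  have -> : L + 1 = 2%:R%:M + (L - 1).
    have -> : 2%:R%:M = 1 + 1 :> 'M[F]_n by rewrite -raddfD.
    by rewrite [RHS]addrC addrA subrK.
  apply: nilpotentmx_unit => //; apply: contra n2 => /eqP e2.
  by rewrite eq_sym -subr_eq0 opprK -mulr2n e2.
pose l := invmx (L + 1).
exists (L + R), (- f).
have -> : row_mx 0 (- f) = row_mx f (- f) *m block_mx 1%:M 0 (- R) 1%:M :> 'rV_(n + n).
  by rewrite mul_row_block !mulmx1 mulmx0 add0r mulmxN mulNmx opprK fR subrr.
apply: (split_off_sign_sim (unit_block1l _) (companion2_triangular L R)).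
pose T : 'M[F]_(n + n) := block_mx R 1%:M 0 L.
pose v : 'cV[F]_(n + n) := col_mx b 0.
pose w : 'rV[F]_(n + n) := row_mx f (- f *m l).
have Tv : T *m v = - v.
  by rewrite mul_block_col !mulmx0 mul0mx !addr0 Rb opp_col_mx oppr0.
have wT : w *m T = - w.
  rewrite mul_row_block mulmx0 addr0 fR mulmx1 opp_row_mx; congr row_mx.
  have -> : L = (L + 1) - 1 by rewrite addrK.
  rewrite mulmxBr -mulmxA mulVmx // !mulmx1.
  by rewrite addrA subrr sub0r.
have wv : w *m v = 1%:M by rewrite mul_row_col mulmx0 addr0.
exists v, w, (row_mx 0 ((f - f *m l) *m l)); split; split=> //.
- by rewrite mul_row_col mulmx0 addr0.
- rewrite -block_mx1 add_block_mx !addr0 mul_row_block !mul0mx mulmx0 !add0r.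
  rewrite -mulmxA mulVmx // mulmx1 opp_row_mx add_row_mx subrr opprK.
  by congr row_mx; rewrite mulNmx addrC.
- by rewrite mul_row_col mul0mx mulmx0 addr0.
pose e := v *m w.
have e0 : e * e = e by rewrite -mulmxE mulmxA -(mulmxA v) wv mulmx1.
have ee : (1 - e) * (1 - e) = 1 - e by rewrite mulrBr mulr1 mulrBl mul1r e0 subrr subr0.
have eT : e * T = - e by rewrite -mulmxE -mulmxA wT mulmxN.
have Te : T * e = - e by rewrite -mulmxE mulmxA Tv mulNmx.
have cT : (1 - e) * (T - 1) = (T - 1) * (1 - e).
  by rewrite mulrBl mul1r mulrBr mulr1 [in RHS]mulrBr mulr1 mulrBl mul1r eT Te.
apply: nilpotent_graded_split => //.
- by rewrite mulrA cT -mulrA ee.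
- by rewrite -mulrA ee.
have -> : v *m w = block_mx (b *m f) (- (b *m f *m l)) 0 0.
  by rewrite mul_col_row !mul0mx mulNmx mulmxN mulmxA.
rewrite /T -block_mx1 !opp_block_mx !add_block_mx !subr0 !sub0r opprK.
rewrite -mulmxE mulmx_block !mul0mx !mulmx0 !mul1mx !mulmx1 !add0r.
by rewrite addr0; apply: nilpotentmx_block.
Qed.

End Companion.

(** * Scalar constant coefficients *)

Section Scalar.
Variable F : fieldType.

(** With X = Z - 2, this companion matrix is similar to [1, 1; X, 1 + X], the
product of [1, 0; X, 1] and [1, 1; 0, 1]. *)
Lemma graded_split_companion2 n (Z : 'M[F]_n) : graded_split 1 (companion2 1%:M Z - 1).
Proof.
pose X := Z - 1 - 1.
apply: (@graded_split_sim _ _ (block_mx 1%:M 0 (- 1%:M) 1%:M) _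
          (block_mx 1%:M 1%:M X (1%:M + X))).
- exact: unit_block1l.
- rewrite /companion2 !mulmx_block !mul0mx !mulmx0 !mul1mx !mulmx1 !addr0 !add0r.
  rewrite subrr mulmxN mulmx1 opprD addrCA subrr addr0.
  by congr block_mx; rewrite addrC /X [RHS]addrC subrK.
exists (block_mx 0 0 X 0), (block_mx 0 1%:M 0 0), (block_mx (- 1%:M) 0 0 1%:M).
rewrite -!mulmxE -block_mx1 !mulmx_block !opp_block_mx !add_block_mx.
rewrite !(mul0mx, mulmx0, mul1mx, mulmx1, mulNmx, mulmxN, add0r, addr0, opprK, oppr0).
by rewrite block_mx0 subrr [1%:M + X]addrC addrK.
Qed.

(** The scalar c is the commutator of M and E.  The matrix g below solves
T g = g T', where T' is the companion matrix of t^2 - Z t + 1; it is invertible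
because 1 + M Z + M^2 = M E. *)
Lemma splittable_commutator n (c : F) (M E : 'M[F]_n) :
  M \in unitmx -> E \in unitmx -> M *m E = c *: (E *m M) -> splittable (c%:M : 'M_n).
Proof.
move=> Mu Eu ME; pose Z := E - M - invmx M.
exists (c *: E - M - c *: invmx M).
have MZ : 1%:M + M *m Z + M *m M = M *m E.
  rewrite /Z !mulmxBr mulmxV //.
  by apply/matrixP => i j; rewrite !mxE; ring.
pose g := block_mx 1%:M M (- M) (1%:M + M *m Z).
have gu : g \in unitmx.
  have -> : g = block_mx 1%:M 0 (- M) 1%:M *m block_mx 1%:M M 0 (M *m E).
    rewrite mulmx_block !mul0mx !mulmx0 !mul1mx !mulmx1 !addr0 -MZ mulNmx.
    by congr block_mx; rewrite [RHS]addrC addrK.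
  by rewrite unitmx_mul unit_block1l unitmxE det_ublock det1 mul1r -unitmxE unitmx_mul Mu.
have gV : invmx g \in unitmx by rewrite unitmx_inv.
apply: (graded_split_sim gV _ (graded_split_companion2 Z)).
suff cg : companion2 c%:M (c *: E - M - c *: invmx M) *m g = g *m companion2 1%:M Z.
  by rewrite -[companion2 c%:M _ in LHS](mulmxK gu) cg !mulmxA mulVmx // mul1mx.
rewrite /companion2 !mulmx_block !mul0mx !mulmx0 !mul1mx !mulmx1 !add0r.
have YM : (c *: E - M - c *: invmx M) *m M = M *m E - M *m M - c%:M.
  by rewrite !mulmxBl -!scalemxAl mulVmx // -ME scalemx1.
pose W := M *m E - M *m M.
have MZW : 1%:M + M *m Z = W by rewrite /W -MZ addrK.
rewrite MZW !mulmxN !mulmx1  YM mulNmx mul_scalar_mx.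
congr block_mx; first by apply/matrixP => i j; rewrite !mxE; ring.
have -> : W = 1%:M + M *m Z by [].
rewrite mulmxDr mulmx1 mulmxA YM -/W mulmxBl mul_scalar_mx MZW.
by rewrite /Z; apply/matrixP => i j; rewrite !mxE; ring.
Qed.

Lemma splittable_empty (C : 'M[F]_0) : splittable C.
Proof. by exists 0; apply: nilpotentmx_graded_split; exists 1%N; apply/matrixP => -[]. Qed.

Definition rot_perm n : 'S_n := perm (@ordS_inj n).

(** As c^n = 1, the sequence c^i is n-periodic; so a cyclic shift of the
diagonal matrix of the c^i multiplies it by c. *)
Lemma splittable_scalar n (c : F) : c ^+ n = 1 -> splittable (c%:M : 'M_n).
Proof.
case: n => [|n] cn; first exact: splittable_empty.
have c0 : c != 0.
  by apply/eqP => c0; move/eqP: cn; rewrite c0 expr0n eq_sym oner_eq0.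
apply: (@splittable_commutator _ _ (perm_mx (rot_perm n.+1))
          (diag_mx (\row_i c ^+ i))).
- exact: unitmx_perm.
- by rewrite unitmxE det_diag unitfE prodf_seq_neq0; apply/allP => i _; rewrite mxE expf_neq0.
apply/matrixP => i j; rewrite mul_mx_diag mul_diag_mx !mxE permE.
case: eqP => [<-|_]; last by rewrite mul0r !mulr0.
by rewrite mul1r mulr1 /= expr_mod // exprS.
Qed.

(** Diagonal matrices, and two by two blocks of them, are handled entrywise:
identities between them become identities in F. *)
Definition diagf n (f : 'I_n -> F) : 'M[F]_n := diag_mx (\row_i f i).

Lemma diagf_mul n (f g : 'I_n -> F) : diagf f *m diagf g = diagf (fun i => f i * g i).
Proof. by rewrite mulmx_diag; congr diag_mx; apply/rowP => i; rewrite !mxE. Qed.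

Lemma diagf_add n (f g : 'I_n -> F) : diagf f + diagf g = diagf (fun i => f i + g i).
Proof. by rewrite -raddfD; congr diag_mx; apply/rowP => i; rewrite !mxE. Qed.

Lemma diagf_opp n (f : 'I_n -> F) : - diagf f = diagf (fun i => - f i).
Proof. by rewrite -raddfN; congr diag_mx; apply/rowP => i; rewrite !mxE. Qed.

Lemma diagf_const n (c : F) : diagf (fun _ : 'I_n => c) = c%:M.
Proof. by rewrite -diag_const_mx; congr diag_mx; apply/rowP => i; rewrite !mxE. Qed.

Lemma eq_diagf n (f g : 'I_n -> F) : f =1 g -> diagf f = diagf g.
Proof. by move=> fg; congr diag_mx; apply/rowP => i; rewrite !mxE. Qed.

Lemma delta_diagf n (l : 'I_n) (f : 'I_n -> F) :
  (delta_mx 0 l : 'rV_n) *m diagf f = f l *: delta_mx 0 l.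
Proof.
apply/rowP => j; rewrite mul_mx_diag !mxE eqxx mulrC /=.
by case: eqP => [->|]; rewrite ?mulr0.
Qed.

Lemma diagf_delta n (l : 'I_n) (f : 'I_n -> F) :
  diagf f *m (delta_mx l 0 : 'cV_n) = f l *: delta_mx l 0.
Proof.
apply/colP => j; rewrite mul_diag_mx !mxE eqxx andbT.
by case: eqP => [->|]; rewrite ?mulr0.
Qed.

Lemma delta_delta_diagf n (l : 'I_n) :
  (delta_mx l 0 : 'cV[F]_n) *m (delta_mx 0 l : 'rV_n) = diagf (fun i => (i == l)%:R).
Proof.
rewrite mul_delta_mx; apply/matrixP => i j; rewrite !mxE.
have [->|ij] := eqVneq i j; first by rewrite andbb mulr1n.
rewrite mulr0n; case: eqP => //= il; case: eqP => // jl.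
by rewrite il jl eqxx in ij.
Qed.

Definition block4 n (a b c d : 'I_n -> F) : 'M[F]_(n + n) :=
  block_mx (diagf a) (diagf b) (diagf c) (diagf d).

Lemma block4M n (a b c d a' b' c' d' : 'I_n -> F) :
  block4 a b c d * block4 a' b' c' d' =
  block4 (fun i => a i * a' i + b i * c' i) (fun i => a i * b' i + b i * d' i)
         (fun i => c i * a' i + d i * c' i) (fun i => c i * b' i + d i * d' i).
Proof. by rewrite -mulmxE mulmx_block !diagf_mul !diagf_add. Qed.

Lemma block4D n (a b c d a' b' c' d' : 'I_n -> F) :
  block4 a b c d + block4 a' b' c' d' =
  block4 (fun i => a i + a' i) (fun i => b i + b' i)
         (fun i => c i + c' i) (fun i => d i + d' i).
Proof. by rewrite add_block_mx !diagf_add. Qed.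

Lemma block4N n (a b c d : 'I_n -> F) :
  - block4 a b c d = block4 (fun i => - a i) (fun i => - b i)
                            (fun i => - c i) (fun i => - d i).
Proof. by rewrite opp_block_mx !diagf_opp. Qed.

Lemma eq_block4 n (a b c d a' b' c' d' : 'I_n -> F) :
  a =1 a' -> b =1 b' -> c =1 c' -> d =1 d' -> block4 a b c d = block4 a' b' c' d'.
Proof. by move=> *; congr block_mx; apply: eq_diagf. Qed.

Lemma block4_const n (x : F) : block4 (fun _ : 'I_n => x) (fun=> 0) (fun=> 0) (fun=> x) = x%:M.
Proof. by rewrite /block4 !diagf_const [RHS]scalar_mx_block raddf0. Qed.

(** If x y = 1 and x <> -1, then diag(x, y) is graded split, with the formulas
below; the denominator x + 1 is the reason for excluding -1.  At the index l
the first entry is removed by e and the second one is 1. *)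
Lemma graded_split_diag n (l : 'I_n) (x y : 'I_n -> F) :
  (forall i, i != l -> x i * y i = 1 /\ x i != -1) -> y l = 1 ->
  let e := block4 (fun i => (i != l)%:R) (fun=> 0) (fun=> 0) (fun=> 1) in
  graded_split e ((block4 x (fun=> 0) (fun=> 0) y - 1) * e).
Proof.
move=> xy yl e.
pose z i := if i == l then 0 else (x i - 1) / (x i + 1).
exists (block4 z (fun i => - z i) z (fun i => - z i)).
exists (block4 z (fun i => z i * y i) (fun i => - z i * x i) (fun i => - z i)).
exists (block4 (fun i => if i == l then 0 else (x i - 1) / (x i + 1))
               (fun i => if i == l then 0 else 2%:R / (x i + 1))
               (fun i => if i == l then 0 else 2%:R * x i / (x i + 1))
               (fun i => if i == l then 1 else (1 - x i) / (x i + 1))).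
have -> : 1 = block4 (fun _ : 'I_n => 1) (fun=> 0) (fun=> 0) (fun=> 1) by rewrite block4_const.
have -> : 0 = block4 (fun _ : 'I_n => 0) (fun=> 0) (fun=> 0) (fun=> 0).
  by rewrite block4_const raddf0.
rewrite /e !block4N !block4D !block4M !block4D.
have x1 i : i != l -> x i + 1 != 0 by move=> /xy[_]; rewrite -subr_eq0 opprK.
have yE i : i != l -> y i = (x i)^-1.
  by move=> /xy[xy1 _]; rewrite -[RHS]mulr1 -xy1 mulKf //; apply/eqP => x0;
    move/eqP: xy1; rewrite x0 mul0r eq_sym oner_eq0.
have x0 i : i != l -> x i != 0.
  move=> /xy[xy1 _]; apply/eqP => x0.
  by move/eqP: xy1; rewrite x0 mul0r eq_sym oner_eq0.
split; [split | split | split | split | ]; apply: eq_block4 => i; rewrite /z;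
  have [il|il] := eqVneq i l; rewrite ?il ?eqxx ?yl ?(negbTE il) ?(yE _ il) /=;
  first [ring | field; rewrite ?x1 ?x0 //].
Qed.

(** For Y = D + c D^-1, where D = diag(c, ..., c^n), the companion matrix is
similar to diag(D, c D^-1).  Its eigenvalues are c^i and c^-(i - 1) for
1 <= i <= n, that is c^n = -1, 1, and the pairs c^j, c^-j for 0 < j < n.  The
minimality of n keeps -1 out of these pairs. *)
Lemma nearly_splittable_scalar_min n (c : F) : (-1 : F) != 1 -> c ^+ n.+1 = -1 ->
  (forall j, (0 < j < n.+1)%N -> c ^+ j != -1) -> nearly_splittable (c%:M : 'M_n.+1).
Proof.
move=> n2 cn cmin.
have c0 : c != 0.
  by apply/eqP => c0; move/eqP: cn; rewrite c0 expr0n eq_sym oppr_eq0 oner_eq0.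
pose l : 'I_n.+1 := ord_max.
pose x (i : 'I_n.+1) := c ^+ i.+1; pose y (i : 'I_n.+1) := c^-1 ^+ i.
have xy i : x i * y i = c by rewrite /x /y exprS -mulrA -exprMn mulfV // expr1n mulr1.
have xl : x l = -1 by [].
(* c has even order, so no odd power of it is 1; this separates D from c D^-1 *)
have odd_pow i : c ^+ i.*2.+1 != 1.
  apply: contra n2 => /eqP ci.
  have : (c ^+ n.+1) ^+ i.*2.+1 = 1 by rewrite -exprM mulnC exprM ci expr1n.
  by rewrite cn -signr_odd /= odd_double expr1 => ->.
have yx i : y i - x i != 0.
  rewrite subr_eq0; apply: contra (odd_pow i) => /eqP yxi.
  rewrite -addnn -addSn exprD -/(x i) -yxi /y -exprMn mulVf ?expr1n //.
have yl : y l + 1 != 0 by have := yx l; rewrite xl opprK.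
(* diagf z is used to remove the off-diagonal block of the triangular form *)
pose z i := (y i - x i)^-1.
pose a : 'rV[F]_n.+1 := delta_mx 0 l; pose e : 'cV[F]_n.+1 := delta_mx l 0.
have ae : a *m e = 1%:M.
  by rewrite mul_delta_mx; apply/matrixP => i j; rewrite !ord1 !mxE.
pose T := block4 x (fun=> 0) (fun=> 0) y.
have diagf0 : diagf (fun _ : 'I_n.+1 => 0 : F) = 0 by rewrite diagf_const raddf0.
exists (diagf y + diagf x), (- a).
pose g := block_mx 1%:M (- diagf z) 0 1%:M *m block_mx 1%:M 0 (- diagf x) 1%:M.
have -> : row_mx 0 (- a) = row_mx a ((z l - 1) *: a) *m g.
  rewrite /g mulmxA !mul_row_block !mulmx1 !mulmx0 addr0 add0r !mulmxN.
  rewrite delta_diagf scalerBl scale1r addrA addNr add0r mulNmx delta_diagf xl scaleN1r.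
  by rewrite opprK subrr.
have gu : g \in unitmx by rewrite unitmx_mul unit_block1l unit_block1r.
have cE : c%:M = diagf y *m diagf x.
  by rewrite diagf_mul -diagf_const; apply: eq_diagf => i; rewrite mulrC xy.
apply: (@split_off_sign_sim _ _ g _ T) => //.
  rewrite /g -mulmxA cE companion2_triangular !mulmxA; congr (_ *m _).
  rewrite /T /block4 !mulmx_block diagf0 !mul0mx !mulmx0 !mul1mx !mulmx1 !addr0 !add0r.
  congr block_mx; rewrite mulNmx mulmxN !diagf_mul -diagf_const !diagf_opp diagf_add.
  by apply: eq_diagf => i; rewrite /z; field.
exists (col_mx e 0), (row_mx a 0), (row_mx 0 ((1 - z l) / (y l + 1) *: a)).
split; split.
- rewrite mul_block_col diagf0 !mul0mx mulmx0 !addr0 diagf_delta xl scaleN1r.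
  by rewrite opp_col_mx oppr0.
- rewrite mul_row_block diagf0 !mul0mx mulmx0 !addr0 delta_diagf xl scaleN1r.
  by rewrite opp_row_mx oppr0.
- by rewrite mul_row_col mulmx0 addr0.
- by rewrite mul_row_col mulmx0 addr0.
- have -> : 1 = block4 (fun _ : 'I_n.+1 => 1) (fun=> 0) (fun=> 0) (fun=> 1).
    by rewrite block4_const.
  rewrite block4D mul_row_block !mul0mx !add0r.
  rewrite opp_row_mx add_row_mx subrr -!scalemxAl !delta_diagf scale0r scaler0.
  by rewrite sub0r scalerA mulfVK // -scaleNr opprB.
- by rewrite mul_row_col mul0mx mulmx0 addr0.
pose M : 'M[F]_n.+1 := perm_mx (rot_perm n.+1).
pose k : 'M[F]_(n.+1 + n.+1) := block_mx 1%:M 0 0 M.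
have ku : k \in unitmx by rewrite unit_block_diag ?unitmx1 ?unitmx_perm.
pose y' i := y (rot_perm n.+1 i).
have xy' i : i != l -> x i * y' i = 1 /\ x i != -1.
  move=> il; have lti : (i.+1 < n.+1)%N.
    rewrite ltnS ltn_neqAle -ltnS ltn_ord andbT; apply: contra il => /eqP il.
    by apply/eqP/val_inj.
  split; last exact: cmin.
  by rewrite /y' /y permE /= modn_small // -exprMn mulfV // expr1n.
have y'l : y' l = 1 by rewrite /y' /y permE /= modnn expr0.
have := graded_split_conj ku (graded_split_diag xy' y'l).
set E := block4 _ _ _ _; set T' := block4 _ _ _ _.
have -> : col_mx e 0 *m row_mx a 0 = 1 - E.
  rewrite mul_col_row delta_delta_diagf !mul0mx mulmx0.
  have -> : 1 = block4 (fun _ : 'I_n.+1 => 1) (fun=> 0) (fun=> 0) (fun=> 1).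
    by rewrite block4_const.
  rewrite block4N block4D -diagf0; apply: eq_block4 => i; rewrite ?subrr ?subr0 //.
  by case: eqP; rewrite ?subr0 ?subrr.
have -> : 1 - (1 - E) = E by rewrite opprB addrC subrK.
have kE : k *m E = E *m k.
  rewrite /k /E /block4 !mulmx_block diagf0 !diagf_const.
  by rewrite !mul0mx !mulmx0 !mul1mx !mulmx1 !addr0 !add0r.
have kT : k *m T = T' *m k.
  rewrite /k /T /T' /block4 !mulmx_block diagf0.
  rewrite !mul0mx !mulmx0 !mul1mx !mulmx1 !addr0 !add0r; congr block_mx.
  apply/matrixP => i j; rewrite mul_mx_diag mul_diag_mx !mxE permE.
  by case: eqP => [<-|_]; rewrite ?mul0r ?mulr0 // /y' permE mulrC.
have -> : invmx k *m E *m k = E by rewrite -mulmxA -kE mulKmx.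
suff -> : invmx k *m ((T' - 1) * E) *m k = (T - 1) * E by [].
rewrite -!mulmxE -!mulmxA -kE (mulmxA (T' - 1)).
have -> : (T' - 1) *m k = k *m (T - 1) by rewrite mulmxBl mulmxBr kT mul1mx mulmx1.
by rewrite !mulmxA mulVmx // mul1mx.
Qed.

Section DirectSum.
Variables (m n : nat).

Definition in1 : 'M[F]_((m + n) + (m + n), m + m) :=
  block_mx (col_mx 1%:M 0) 0 0 (col_mx 1%:M 0).
Definition in2 : 'M[F]_((m + n) + (m + n), n + n) :=
  block_mx (col_mx 0 1%:M) 0 0 (col_mx 0 1%:M).
Definition pr1 : 'M[F]_(m + m, (m + n) + (m + n)) :=
  block_mx (row_mx 1%:M 0) 0 0 (row_mx 1%:M 0).
Definition pr2 : 'M[F]_(n + n, (m + n) + (m + n)) :=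
  block_mx (row_mx 0 1%:M) 0 0 (row_mx 0 1%:M).

Let simp := (mulmx_block, mul_row_col, mul0mx, mulmx0, mulmx1, addr0, add0r).

Lemma pr1_in1 : pr1 *m in1 = 1%:M.
Proof. by rewrite ?simp -scalar_mx_block. Qed.

Lemma pr2_in2 : pr2 *m in2 = 1%:M.
Proof. by rewrite ?simp -scalar_mx_block. Qed.

Lemma pr1_in2 : pr1 *m in2 = 0.
Proof. by rewrite ?simp block_mx0. Qed.

Lemma pr2_in1 : pr2 *m in1 = 0.
Proof. by rewrite ?simp block_mx0. Qed.

Lemma in_pr : in1 *m pr1 + in2 *m pr2 = 1.
Proof.
rewrite ?simp !mul_col_row ?simp add_block_mx !addr0 -block_mx1.
by rewrite !add_block_mx !addr0 !add0r -!scalar_mx_block.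
Qed.

Variables (C Y : 'M[F]_m) (D Z : 'M[F]_n).
Let T := companion2 (block_mx C 0 0 D) (block_mx Y 0 0 Z).

Lemma companion2_in1 : T *m in1 = in1 *m companion2 C Y.
Proof.
rewrite /T /companion2 ?simp mulmxN opp_block_mx !mul_block_col !mul_col_mx ?simp.
by rewrite !mul1mx opp_col_mx !oppr0 ?simp.
Qed.

Lemma companion2_in2 : T *m in2 = in2 *m companion2 D Z.
Proof.
rewrite /T /companion2 ?simp mulmxN opp_block_mx !mul_block_col !mul_col_mx ?simp.
by rewrite !mul1mx opp_col_mx !oppr0 ?simp.
Qed.

Lemma pr1_companion2 : pr1 *m T = companion2 C Y *m pr1.
Proof.
rewrite /T /companion2 ?simp opp_block_mx !mul_row_block !mul_mx_row ?simp.
by rewrite !mul1mx !oppr0 ?simp.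
Qed.

Lemma companion2_sum : T - 1 =
  in1 *m (companion2 C Y - 1) *m pr1 + in2 *m (companion2 D Z - 1) *m pr2.
Proof.
rewrite !mulmxBr !mulmxBl !mulmx1 -companion2_in1 -companion2_in2 -!mulmxA.
by rewrite addrACA -mulmxDr -opprD in_pr mulmx1.
Qed.

Lemma split_off_sign_sum h : split_off_sign (companion2 C Y) (row_mx 0 h) ->
  graded_split 1 (companion2 D Z - 1) -> split_off_sign T (row_mx 0 (row_mx h 0)).
Proof.
move=> [v [f [q [[Tv fT fv hv] [qT qv s1]]]]] s2.
have -> : row_mx 0 (row_mx h 0) = row_mx 0 h *m pr1.
  by rewrite mul_row_block ?simp mul_mx_row ?simp.
exists (in1 *m v), (f *m pr1), (q *m pr1).
have pK k l (A : 'M_(k, m + m)) (B : 'M_(m + m, l)) :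
    A *m pr1 *m (in1 *m B) = A *m B.
  by rewrite mulmxA -(mulmxA A) pr1_in1 mulmx1.
split; split; rewrite ?pK //.
- by rewrite mulmxA companion2_in1 -mulmxA Tv mulmxN.
- by rewrite -mulmxA pr1_companion2 mulmxA fT mulNmx.
- have pT : pr1 *m (T + 1) = (companion2 C Y + 1) *m pr1.
    by rewrite mulmxDr mulmxDl pr1_companion2 mul1mx mulmx1.
  by rewrite -mulmxA pT mulmxA qT mulmxBl.
have e1 : 1 - in1 *m v *m (f *m pr1) =
    in1 *m (1 - v *m f) *m pr1 + in2 *m 1%:M *m pr2.
  rewrite -in_pr mulmxBr mulmxBl !mulmx1 !mulmxA addrAC //.
have o12 p p' (A : 'M[F]_p) (B : 'M_p') (i : 'M_(_, p)) (j : 'M_(p, _))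
    (i' : 'M_(_, p')) (j' : 'M_(p', _)) :
    j *m i' = 0 -> (i *m A *m j) * (i' *m B *m j') = 0 :> 'M[F]_(m + n + (m + n)).
  by move=> ji; rewrite -mulmxE !mulmxA -(mulmxA _ j) ji mulmx0 !mul0mx.
have -> : (T - 1) * (1 - in1 *m v *m (f *m pr1)) =
    in1 *m ((companion2 C Y - 1) * (1 - v *m f)) *m pr1
    + in2 *m (companion2 D Z - 1) *m pr2.
  rewrite e1 companion2_sum mulrDl [X in X + _ = _]mulrDr [X in _ + X = _]mulrDr.
  rewrite !(o12 _ _ _ _ _ _ _ _ pr1_in2).
  rewrite !(o12 _ _ _ _ _ _ _ _ pr2_in1) addr0 add0r.
  by rewrite (lift_mul pr1_in1) (lift_mul pr2_in2) mulr1.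
rewrite e1; apply: graded_splitD.
- by apply: o12; exact: pr1_in2.
- by apply: o12; exact: pr2_in1.
- exact (graded_split_lift pr1_in1 s1).
exact (graded_split_lift pr2_in2 s2).
Qed.

End DirectSum.

Lemma nearly_splittable_sum m n (C : 'M[F]_m) (D : 'M[F]_n) :
  nearly_splittable C -> splittable D -> nearly_splittable (block_mx C 0 0 D).
Proof.
move=> [Y [h q]] [Z s]; exists (block_mx Y 0 0 Z), (row_mx h 0).
exact: split_off_sign_sum.
Qed.

(** If j is the least exponent with c^j = -1, then c^(n - j) = 1: the scalar
matrix is the direct sum of the minimal case and of a splittable one. *)
Lemma nearly_splittable_scalar n (c : F) : (-1 : F) != 1 -> c ^+ n = -1 ->
  nearly_splittable (c%:M : 'M_n).
Proof.
move=> n2; case: n => [|n] cn; first by rewrite expr0 in cn; rewrite -cn eqxx in n2.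
have exj : exists j, c ^+ j.+1 == -1 by exists n; apply/eqP.
case: (ex_minnP exj) => j /eqP cj minj.
have lejn : (j.+1 <= n.+1)%N by rewrite ltnS minj // cn.
rewrite -(subnKC lejn) scalar_mx_block; apply: nearly_splittable_sum.
  apply: nearly_splittable_scalar_min => // -[//|i] /andP[_ ij]; apply: contraL ij => /minj.
  by rewrite -leqNgt.
apply: splittable_scalar; apply: (@mulfI _ (c ^+ j.+1)).
  by rewrite cj oppr_eq0 oner_eq0.
by rewrite -exprD subnKC // cn cj mulr1.
Qed.

Lemma nonscalar_1 n (C : 'M[F]_(1 + n)) : ~~ is_scalar_mx C -> (0 < n)%N.
Proof.
case: n C => // C /negP[]; apply/is_scalar_mxP; exists (C 0 0).
by apply/matrixP => i j; rewrite !ord1 mxE eqxx mulr1n.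
Qed.

Lemma splittable_det n (C : 'M[F]_n) : \det C = 1 -> splittable C.
Proof.
case: n C => [|n] C dC; first exact: splittable_empty.
have [/is_scalar_mxP[c Cc]|Cns] := boolP (is_scalar_mx C).
  by rewrite Cc; apply: splittable_scalar; rewrite -det_scalar -Cc.
have [|L [R [CLR Ln Rn]]] := nonscalar_LR (nonscalar_1 Cns) Cns dC.
  by rewrite oner_eq0.
apply: splittable_sim CLR _; apply: splittable_LR => //.
by move: Rn; rewrite /nearly_unipotent eqxx.
Qed.

Lemma nearly_splittable_det n (C : 'M[F]_n) : (-1 : F) != 1 -> \det C = -1 -> nearly_splittable C.
Proof.
move=> n2; case: n C => [|n] C dC.
  by move: n2; rewrite -dC det_mx00 eqxx.
have [/is_scalar_mxP[c Cc]|Cns] := boolP (is_scalar_mx C).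
  by rewrite Cc; apply: nearly_splittable_scalar; rewrite -?det_scalar -?Cc.
have [|L [R [CLR Ln Rn]]] := nonscalar_LR (nonscalar_1 Cns) Cns dC.
  by rewrite oppr_eq0 oner_eq0.
by apply: nearly_splittable_sim CLR _; apply: nearly_splittable_LR.
Qed.

End Scalar.

(** * The matrix theorem *)

Section Matrices.
Variable F : fieldType.

Lemma graded_split_jordan2 :
  graded_split 1 (block_mx (- 1%:M) 0 1%:M (- 1%:M) - 1 : 'M[F]_(1 + 1)).
Proof.
exists (block_mx 0 (- 4%:R%:M) 0 0),
  (block_mx 2%:R%:M (- 4%:R%:M) 1%:M (- 2%:R%:M)),
  (block_mx 1%:M (- 4%:R%:M) 0 (- 1%:M)).
rewrite -!mulmxE -block_mx1 !mulmx_block !opp_block_mx !add_block_mx.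
split; [split | split | split | split | ];
  first [rewrite -[RHS]block_mx0; congr block_mx | congr block_mx];
  by apply/matrixP => i j; rewrite (ord1 i) (ord1 j) ?mxE ?big_ord1 ?mxE /= ?mulr1n; ring.
Qed.

(** G and H span the two-dimensional part made of v and the new vector, on which
the matrix is a Jordan block for -1; G' and H' transport the complement of v.
Both parts are graded split, and they are orthogonal. *)
Lemma split_off_sign_ext m (T : 'M[F]_m) h : split_off_sign T h ->
  graded_split 1 (block_mx T 0 h (- 1%:M) - 1 : 'M_(m + 1)).
Proof.
move=> [v [f [q [[Tv fT fv hv] [qT qv s]]]]].
set S := block_mx _ _ _ _.
pose G : 'M[F]_(m + 1, 1 + 1) := block_mx v 0 0 1%:M.
pose H : 'M[F]_(1 + 1, m + 1) := block_mx f 0 q 1%:M.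
pose G' : 'M[F]_(m + 1, m) := col_mx 1%:M (- q).
pose H' : 'M[F]_(m, m + 1) := row_mx 1%:M 0.
have HG : H *m G = 1%:M.
  rewrite mulmx_block !mul0mx !mulmx0 !addr0 fv qv mulmx1 add0r.
  by rewrite -scalar_mx_block.
have HG' : H' *m G' = 1%:M by rewrite mul_row_col mulmx1 mul0mx addr0.
have e0 : (v *m f) *m v = v by rewrite -mulmxA fv mulmx1.
have ce : G *m 1%:M *m H + G' *m (1 - v *m f) *m H' = 1.
  rewrite mulmx1 /G' (mul_col_mx 1%:M (- q)) /H' (mul_col_row _ _ 1%:M 0) mulmx_block.
  rewrite !mul0mx !mulmx0 !mulmx1 !mul1mx !addr0 !add0r mulNmx mulmxBr mulmx1.
  rewrite mulmxA qv mul0mx subr0 add_block_mx !addr0 -block_mx1.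
  by rewrite addrC subrK subrr.
have cN : G *m (block_mx (- 1%:M) 0 1%:M (- 1%:M) - 1) *m H
    + G' *m ((T - 1) * (1 - v *m f)) *m H' = S - 1.
  have qN : q *m ((T - 1) * (1 - v *m f)) = f - h - q - q.
    have qT1 : q *m (T - 1) = f - h - q - q.
      by rewrite -qT mulmxBr mulmxDr !mulmx1 addrK.
    rewrite -mulmxE mulmxA qT1 mulmxBr mulmx1 mulmxA.
    have -> : (f - h - q - q) *m v = 0 by rewrite !mulmxBl fv hv qv subrr !subr0.
    by rewrite mul0mx subr0.
  have TN : (T - 1) * (1 - v *m f) = T - 1 + v *m f + v *m f.
    have Te : T * (v *m f) = - (v *m f) by rewrite -mulmxE mulmxA Tv mulNmx.
    by rewrite mulrBr mulr1 mulrBl mul1r Te opprD !opprK addrA.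
  have J1 : block_mx (- 1%:M) 0 1%:M (- 1%:M) - 1 =
      block_mx (- 1%:M - 1%:M) 0 1%:M (- 1%:M - 1%:M) :> 'M[F]_(1 + 1).
    by rewrite -block_mx1 opp_block_mx add_block_mx !subr0.
  have S1 : S - 1 = block_mx (T - 1) 0 h (- 1%:M - 1%:M).
    by rewrite -block_mx1 opp_block_mx add_block_mx !subr0.
  rewrite J1 S1 !mulmx_block !mul0mx !mulmx0 !addr0 !add0r !mul1mx !mulmx1.
  rewrite /G' (mul_col_mx 1%:M (- q)) /H' (mul_col_row _ _ 1%:M 0) add_block_mx.
  rewrite !mulmx0 !mulmx1 mul1mx !addr0 mulNmx qN TN; congr block_mx.
    rewrite mulmxBr mulmxN mulmx1 mulmxBl mulNmx -opprD mul0mx addr0.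
    by rewrite addrC -(addrA (T - 1)) addrK.
  rewrite mulmxBl mulNmx mul1mx.
  by apply/matrixP => i j; rewrite !mxE; ring.
have HG'0 : H *m G' *m (1 - v *m f) = 0.
  rewrite mul_block_col !mul1mx !mulmx1 mul0mx addr0 subrr mul_col_mx mul0mx.
  by rewrite mulmxBr mulmx1 mulmxA fv mul1mx subrr col_mx0.
have H'G0 : (1 - v *m f) *m (H' *m G) = 0.
  rewrite mul_row_block !mul1mx !mul0mx !addr0 mul_mx_row mulmx0.
  by rewrite mulmxBl mul1mx e0 subrr row_mx0.
rewrite -cN -[X in graded_split X _]ce; apply: graded_splitD.
- rewrite -mulmxE -!mulmxA (mulmxA H G') (mulmxA (H *m G')) HG'0.
  by rewrite mul0mx !mulmx0.
- rewrite -mulmxE -!mulmxA (mulmxA H' G) (mulmxA (1 - v *m f)) H'G0.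
  by rewrite mul0mx !mulmx0.
- exact (graded_split_lift HG graded_split_jordan2).
exact (graded_split_lift HG' s).
Qed.

Lemma graded_split_two_involutions m (T : 'M[F]_m) : graded_split 1 (T - 1) ->
  exists y z, [/\ involution y, involution z & T = y * z].
Proof.
move=> /graded_split_involution[y [z [yy zz _ _ e]]]; exists y, z.
by split; rewrite /involution /= ?expr2 // -e addrC subrK.
Qed.

(** The involutions obtained on the complement are completed by 1 and -1 on the
line where T acts as -1. *)
Lemma split_off_sign_two_involutions m (T : 'M[F]_m) h : split_off_sign T h ->
  exists y z, [/\ involution y, involution z & T = y * z].
Proof.
move=> [v [f [q [[Tv fT fv hv] [qT qv s]]]]].
have [ee _ _] := graded_split_corner s.
have [y [z [yy zz [ey ye] [ez ze] e]]] := graded_split_involution s.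
pose e0 := v *m f; rewrite -/e0 in ee yy zz ey ye ez ze e s.
have e0e : e0 * e0 = e0 by rewrite -mulmxE mulmxA -(mulmxA v) fv mulmx1.
have e0y : e0 * y = 0 by rewrite -ey mulrA mulrBr mulr1 e0e subrr mul0r.
have ye0 : y * e0 = 0 by rewrite -ye -mulrA mulrBl mul1r e0e subrr mulr0.
have e0z : e0 * z = 0 by rewrite -ez mulrA mulrBr mulr1 e0e subrr mul0r.
have ze0 : z * e0 = 0 by rewrite -ze -mulrA mulrBl mul1r e0e subrr mulr0.
exists (y + e0), (z - e0); rewrite /involution /= !expr2.
split.
- by rewrite mulrDl !mulrDr yy e0y ye0 e0e addr0 add0r subrK.
- by rewrite mulrBl !mulrBr zz e0z ze0 e0e subr0 sub0r opprK subrK.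
rewrite mulrDl !mulrBr e0z ye0 e0e subr0 sub0r -e.
transitivity (T * (1 - e0) + T * e0); first by rewrite -mulrDr subrK mulr1.
have -> : T * e0 = - e0 by rewrite -mulmxE mulmxA Tv mulNmx.
by congr (_ - _); rewrite mulrBl mul1r [RHS]addrC subrK.
Qed.

Definition dsum1 m (T : 'M[F]_m) : 'M[F]_(m + 1) := block_mx T 0 0 1%:M.

Lemma dsum1M m (S T : 'M[F]_m) : dsum1 (S * T) = dsum1 S * dsum1 T.
Proof. by rewrite -!mulmxE mulmx_block !mul0mx !mulmx0 mulmx1 !addr0 add0r. Qed.

Lemma dsum1_1 m : dsum1 (1 : 'M[F]_m) = 1.
Proof. exact: block_mx1. Qed.

Lemma involution_dsum1 m (x : 'M[F]_m) : involution x -> involution (dsum1 x).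
Proof. by rewrite /involution /= !expr2 -dsum1M => ->; exact: dsum1_1. Qed.

Lemma unipotent2_dsum1 m (x : 'M[F]_m) : unipotent2 x -> unipotent2 (dsum1 x).
Proof.
rewrite /unipotent2 /= !expr2 -dsum1_1 => xx.
have -> : dsum1 x - dsum1 1 = block_mx (x - 1) 0 0 0.
  by rewrite opp_block_mx add_block_mx !subrr.
by rewrite -mulmxE mulmx_block !mul0mx !mulmx0 !addr0 mulmxE xx block_mx0.
Qed.

Definition unit_ext n (A : 'M[F]_n) : 'M[F]_(n + n) := block_mx A 1%:M 0 1%:M.

Lemma unit_ext_companion2 n (A : 'M[F]_n) :
  block_mx 1%:M 0 (- A) 1%:M *m companion2 A (1 + A)
    = unit_ext A *m block_mx 1%:M 0 (- A) 1%:M.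
Proof. by have := companion2_triangular 1%:M A; rewrite mul1mx. Qed.

Lemma unipotent_factor n (A Y : 'M[F]_n) : exists2 x, unipotent2 x
  & companion2 A (1 + A) = x * companion2 A Y.
Proof.
exists (block_mx 1%:M 0 (1 + A - Y) 1%:M).
  rewrite /unipotent2 /= expr2 -block_mx1 opp_block_mx add_block_mx !subrr !subr0.
  by rewrite -mulmxE mulmx_block !mul0mx !mulmx0 !addr0 block_mx0.
rewrite -mulmxE mulmx_block !mul0mx !mulmx0 !mul1mx mulmx1 !addr0 add0r.
by rewrite subrK.
Qed.

Definition lower_sign n (G : 'M[F]_n) : 'M[F]_(n + n) :=
  block_mx 1%:M 0 G (- 1%:M).

Lemma lower_sign_sqr n (G : 'M[F]_n) : lower_sign G *m lower_sign G = 1%:M.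
Proof.
rewrite mulmx_block !mul0mx !mulmx0 !mulmx1 !addr0.
by rewrite !mulNmx ?mul1mx ?mulmx1 ?opprK ?add0r subrr -scalar_mx_block.
Qed.

Lemma companion2_lower_sign n (A Y : 'M[F]_n) :
  companion2 A (1 + A) = lower_sign (1 + A + Y) *m companion2 (- A) Y.
Proof.
rewrite mulmx_block !mul0mx !mulmx0 !mul1mx mulmx1 !addr0 add0r.
by rewrite !mulNmx !mul1mx opprK addrK.
Qed.

Lemma involution_factor n (A Y : 'M[F]_n) : exists2 x, involution x
  & companion2 A (1 + A) = x * companion2 (- A) Y.
Proof.
exists (lower_sign (1 + A + Y)); last exact: companion2_lower_sign.
by rewrite /involution /= expr2; exact: lower_sign_sqr.
Qed.

(** The involution also changes the sign of the additional vector; its row h is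
free and becomes the row appended to the companion matrix. *)
Lemma involution_factor_ext n (A Y : 'M[F]_n) h : exists2 x, involution x
  & dsum1 (companion2 A (1 + A))
      = x * block_mx (companion2 (- A) Y) 0 (row_mx 0 h) (- 1%:M).
Proof.
exists (block_mx (lower_sign (1 + A + Y)) 0 (row_mx h 0) (- 1%:M)).
  rewrite /involution /= expr2 -mulmxE mulmx_block !mul0mx !mulmx0 !addr0 !add0r.
  rewrite lower_sign_sqr mul_row_block !mulmx0 !mul0mx mulmx1 !addr0 !mulNmx !mul1mx.
  by rewrite subrr opprK block_mx1.
rewrite -mulmxE mulmx_block !mul0mx !mulmx0 !addr0 !add0r -companion2_lower_sign.
rewrite mul_row_block !mulmx0 !mul0mx mulmx1 !addr0 !mulNmx !mul1mx subrr opprK.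
by [].
Qed.

Lemma det_opp_pm1 n (A : 'M[F]_n) : \det A = 1 \/ \det A = -1 ->
  \det (- A) = 1 \/ \det (- A) = -1.
Proof.
rewrite -scaleN1r detZ -signr_odd; case: (odd n); rewrite /= ?expr0 ?expr1.
  by case=> ->; rewrite !mulN1r ?opprK; [right | left].
by rewrite mul1r.
Qed.

Lemma companion2_two_involutions n (C : 'M[F]_n) : \det C = 1 \/ \det C = -1 ->
  exists Y y z, [/\ involution y, involution z & companion2 C Y = y * z].
Proof.
move=> dC; have [n1|n1] := eqVneq (-1 : F) 1.
  have [|Y s] := @splittable_det F n C; first by case: dC => // ->.
  by exists Y; apply: graded_split_two_involutions.
case: dC => dC.
  have [Y s] := splittable_det dC.
  by exists Y; apply: graded_split_two_involutions.
have [Y [h s]] := nearly_splittable_det n1 dC.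
by exists Y; apply: split_off_sign_two_involutions s.
Qed.

Local Notation Inv m := (@involution 'M[F]_m).
Local Notation Unip m := (@unipotent2 'M[F]_m).

Lemma unit_ext_prod3 n (X Y Z : set 'M[F]_(n + n + 1)) (A : 'M[F]_n) :
  conj_closed X -> conj_closed Y -> conj_closed Z ->
  prod3 X Y Z (dsum1 (companion2 A (1 + A))) -> prod3 X Y Z (dsum1 (unit_ext A)).
Proof.
move=> cX cY cZ; pose g : 'M[F]_(n + n) := block_mx 1%:M 0 (- A) 1%:M.
have gu : g \in unitmx by exact: unit_block1l.
have -> : unit_ext A = g * companion2 A (1 + A) * invmx g.
  by rewrite -!mulmxE unit_ext_companion2 mulmxK.
rewrite !dsum1M; apply: prod3_conj => //; rewrite -dsum1M -mulmxE.
  by rewrite mulVmx ?dsum1_1.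
by rewrite mulmxV ?dsum1_1.
Qed.

Section Factorizations.
Variables (n : nat) (A : 'M[F]_n).
Hypothesis detA : \det A = 1 \/ \det A = -1.
Local Notation N := (n + n + 1)%N.

Lemma unit_ext_III : prod3 (Inv N) (Inv N) (Inv N) (dsum1 (unit_ext A)).
Proof.
apply: unit_ext_prod3; do ?exact: involution_conj.
have [Y [y [z [yI zI yz]]]] := companion2_two_involutions (det_opp_pm1 detA).
have [x xI ->] := involution_factor A Y.
exists (dsum1 x), (dsum1 y), (dsum1 z).
by split; try exact: involution_dsum1; rewrite -mulrA -!dsum1M yz.
Qed.

Lemma unit_ext_UII : prod3 (Unip N) (Inv N) (Inv N) (dsum1 (unit_ext A)).
Proof.
apply: unit_ext_prod3; do ?[exact: involution_conj | exact: unipotent2_conj].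
have [Y [y [z [yI zI yz]]]] := companion2_two_involutions detA.
have [x xU ->] := unipotent_factor A Y.
exists (dsum1 x), (dsum1 y), (dsum1 z).
by split; try exact: involution_dsum1; try exact: unipotent2_dsum1;
  rewrite -mulrA -!dsum1M yz.
Qed.

Lemma graded_split_two_unipotents m (T : 'M[F]_m) : graded_split 1 (T - 1) ->
  exists y z, [/\ unipotent2 y, unipotent2 z & T = y * z].
Proof. by move=> /graded_split_unipotent2; rewrite addrC subrK. Qed.

(** If det (- A) = -1 differs from 1, then no product of two unipotents has the determinant of
the companion matrix, and the extended involution is needed. *)
Lemma unit_ext_IUU : prod3 (Inv N) (Unip N) (Unip N) (dsum1 (unit_ext A)).
Proof.
apply: unit_ext_prod3; do ?[exact: involution_conj | exact: unipotent2_conj].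
have pos : \det (- A) = 1 ->
    prod3 (Inv N) (Unip N) (Unip N) (dsum1 (companion2 A (1 + A))).
  move=> /splittable_det[Y] /graded_split_two_unipotents[y [z [yU zU yz]]].
  have [x xI ->] := involution_factor A Y.
  exists (dsum1 x), (dsum1 y), (dsum1 z).
  by split; try exact: involution_dsum1; try exact: unipotent2_dsum1;
    rewrite -mulrA -!dsum1M yz.
have [n1|n1] := eqVneq (-1 : F) 1.
  by apply: pos; case: (det_opp_pm1 detA) => // ->.
case: (det_opp_pm1 detA) => [/pos //|dA].
have [Y [h /split_off_sign_ext]] := nearly_splittable_det n1 dA.
move=> /graded_split_two_unipotents[y [z [yU zU yz]]].
have [x xI ->] := involution_factor_ext A Y h.
by exists x, y, z; split=> //; rewrite yz mulrA.
Qed.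

Lemma unit_ext_UUU : \det A = 1 -> prod3 (Unip N) (Unip N) (Unip N) (dsum1 (unit_ext A)).
Proof.
move=> dA; apply: unit_ext_prod3; do ?exact: unipotent2_conj.
have [Y /graded_split_two_unipotents[y [z [yU zU yz]]]] := splittable_det dA.
have [x xU ->] := unipotent_factor A Y.
exists (dsum1 x), (dsum1 y), (dsum1 z).
by split; try exact: unipotent2_dsum1; rewrite -mulrA -!dsum1M yz.
Qed.

End Factorizations.
End Matrices.

(** * Linear forms and extension to the whole space *)

Section Functionals.
Variables (F : fieldType) (V : lmodType F).

Definition lin_closed (K : set V) : Prop :=
  forall a x y, K x -> K y -> K (a *: x + y).

Lemma lspan_closed n (e : 'I_n -> V) : lin_closed (lspan e).
Proof.
move=> a _ _ [c ->] [d ->]; exists (fun i => a * c i + d i).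
rewrite scaler_sumr -big_split /=; apply: eq_bigr => i _.
by rewrite scalerDl scalerA.
Qed.

Definition lin_form (f : V -> F) : Prop :=
  forall a x y, f (a *: x + y) = a * f x + f y.

Lemma lin_form0 f : lin_form f -> f 0 = 0.
Proof.
move=> fl; have := fl 1 0 0; rewrite scale1r addr0 mul1r => /eqP.
by rewrite -subr_eq0 opprD addNKr oppr_eq0 => /eqP.
Qed.

(** A subspace K maximal among those which contain U but not v has codimension
1.  Zorn's lemma is applied to the sets K such that K `|` U is such a subspace,
because a union over an empty chain is empty. *)
Lemma functional_avoiding (U : set V) (v : V) :
  U 0 -> lin_closed U -> ~ U v ->
  exists f : V -> F, [/\ lin_form f, f v = 1 & forall x, U x -> f x = 0].
Proof.
move=> U0 Ulin Uv.
pose P (K : set V) := lin_closed (K `|` U) /\ ~ (K `|` U) v.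
have [K [[Klin Kv] Kmax]] : exists K, P K /\ forall B, K `<` B -> ~ P B.
  apply: Zorn_bigcup => C CP Ctot; split.
    move=> a x y; case=> [[X CX Xx]|Ux]; case=> [[Y CY Yy]|Uy].
    - case: (Ctot _ _ CX CY) => [XY|YX].
        have [lin _] := CP _ CY.
        by case: (lin a x y (or_introl (XY _ Xx)) (or_introl Yy)); [left; exists Y | right].
      have [lin _] := CP _ CX.
      by case: (lin a x y (or_introl Xx) (or_introl (YX _ Yy))); [left; exists X | right].
    - have [lin _] := CP _ CX.
      by case: (lin a x y (or_introl Xx) (or_intror Uy)); [left; exists X | right].
    - have [lin _] := CP _ CY.
      by case: (lin a x y (or_intror Ux) (or_introl Yy)); [left; exists Y | right].
    - by right; apply: Ulin.
  case=> [[X CX Xv]|//]; have [_ Xnv] := CP _ CX; by apply: Xnv; left.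
pose W := K `|` U.
have W0 : W 0 by right.
have Wadd x y : W x -> W y -> W (x + y).
  by move=> Wx Wy; have := Klin 1 x y Wx Wy; rewrite scale1r.
have Wscale a x : W x -> W (a *: x).
  by move=> Wx; have := Klin a x 0 Wx W0; rewrite addr0.
have dec x : exists c, W (x - c *: v).
  have [Wx|nWx] := pselect (W x); first by exists 0; rewrite scale0r subr0.
  pose B := [set y | exists2 a, W (y - a *: x) & True].
  have KB : K `<` B.
    split=> [|BK]; last by apply: nWx; left; apply: BK; exists 1; rewrite ?scale1r ?subrr.
    by move=> y Ky; exists 0; rewrite ?scale0r ?subr0 //; left.
  have := Kmax B KB; rewrite /P => /not_andP[|].
    case=> a y z; have BU t : (B `|` U) t -> B t.
      by case=> // Ut; exists 0; rewrite ?scale0r ?subr0 //; right.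
    move=> /BU[b Wy _] /BU[b' Wz _]; left; exists (a * b + b') => //.
    rewrite scalerDl -scalerA opprD addrACA -scalerBr.
    exact: Klin.
  move=> /contrapT[[a Wva _]|//].
  have a0 : a != 0.
    by apply/eqP => a0; apply: Kv; move: Wva; rewrite a0 scale0r subr0.
  exists a^-1; rewrite -[x](scalerK a0) -scalerBr.
  by apply: (Wscale); rewrite -opprB -scaleN1r; apply: (Wscale).
have [f fE] := choice dec.
have funiq x c : W (x - c *: v) -> f x = c.
  move=> Wc; apply: contrapT => /eqP; rewrite -subr_eq0 => fc; apply: Kv.
  have := Wscale (f x - c)^-1 _ (Wadd _ _ Wc (Wscale (-1) _ (fE x))).
  have -> : x - c *: v + -1 *: (x - f x *: v) = (f x - c) *: v.
    by rewrite scaleN1r opprB [LHS]addrC addrA subrK scalerBl.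
  by rewrite scalerA mulVf // scale1r.
exists f; split=> [a x y||x Ux]; apply: (funiq).
- rewrite scalerDl -scalerA opprD addrACA -scalerBr.
  by apply: (Klin); exact: fE.
- by rewrite scale1r subrr.
by rewrite scale0r subr0; right.
Qed.

Lemma dual_family n (e : 'I_n -> V) : lfree e ->
  exists h : 'I_n -> V -> F, (forall i, lin_form (h i)) /\
    (forall i j, h i (e j) = (i == j)%:R).
Proof.
move=> ef; have E (j : 'I_n) : e j = \sum_i (i == j)%:R *: e i.
  rewrite (bigD1 j) //= eqxx scale1r big1 ?addr0 // => i /negbTE->.
  by rewrite scale0r.
have /choice[h hP] : forall i, exists f : V -> F,
    lin_form f /\ forall j, f (e j) = (i == j)%:R.
  move=> i; pose U := [set v | exists2 c : 'I_n -> F, c i = 0 & v = \sum_j c j *: e j].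
  have [|||f [fl fi fU]] := @functional_avoiding U (e i).
  - by exists (fun=> 0) => //; rewrite big1 // => j _; rewrite scale0r.
  - move=> a _ _ [c ci ->] [d di ->]; exists (fun j => a * c j + d j).
      by rewrite ci di mulr0 addr0.
    rewrite scaler_sumr -big_split /=; apply: eq_bigr => j _.
    by rewrite scalerDl scalerA.
  - move=> [c ci]; rewrite {1}E => /(lfree_inj ef)/(_ i).
    by rewrite ci eqxx => /eqP; rewrite oner_eq0.
  exists f; split=> // j; have [<-//|ij] := eqVneq i j.
  by apply: fU; exists (fun k => (k == j)%:R); rewrite ?(negbTE ij) -?E.
by exists h; split=> i; have [] := hP i.
Qed.

Definition famcat m n (e : 'I_m -> V) (f : 'I_n -> V) (i : 'I_(m + n)) : V :=
  match fintype.split i with inl j => e j | inr k => f k end.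

Lemma famcat_l m n (e : 'I_m -> V) (f : 'I_n -> V) i : famcat e f (lshift n i) = e i.
Proof. by rewrite /famcat -[lshift _ _]/(unsplit (inl i)) unsplitK. Qed.

Lemma famcat_r m n (e : 'I_m -> V) (f : 'I_n -> V) i : famcat e f (rshift m i) = f i.
Proof. by rewrite /famcat -[rshift _ _]/(unsplit (inr i)) unsplitK. Qed.

Lemma sum_famcat m n (e : 'I_m -> V) (f : 'I_n -> V) c :
  \sum_i c i *: famcat e f i =
  \sum_i c (lshift n i) *: e i + \sum_i c (rshift m i) *: f i.
Proof.
rewrite big_split_ord /=; congr (_ + _); apply: eq_bigr => i _.
  by rewrite famcat_l.
by rewrite famcat_r.
Qed.

(** This is the only use of the infinite dimension of V. *)
Lemma free_modulo (m n : nat) (g : 'I_n -> V) : ~ finite_dim [set: V] ->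
  exists x : 'I_m -> V, forall c, lspan g (\sum_i c i *: x i) -> forall i, c i = 0.
Proof.
move=> Vinf; elim: m => [|m [x xP]]; first by exists (fun=> 0) => c _ [].
have [v vP] : exists v, ~ lspan (famcat g x) v.
  apply: contrapT => nv; apply: Vinf; exists _, (famcat g x).
  apply/seteqP; split=> // v _; apply: contrapT => gv; apply: nv; by exists v.
exists (fun i => oapp x v (unlift ord0 i)) => c.
have -> : \sum_i c i *: oapp x v (unlift ord0 i) =
    c ord0 *: v + \sum_i c (lift ord0 i) *: x i.
  by rewrite big_ord_recl unlift_none; congr (_ + _); apply: eq_bigr => i _; rewrite liftK.
have [c0|c0] := eqVneq (c ord0) 0.
  rewrite c0 scale0r add0r => /(xP (fun i => c (lift ord0 i))) cP i.
  by case: (unliftP ord0 i) => [j ->|->].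
case=> d gd; case: vP.
exists (fun i => match fintype.split i with inl j => (c ord0)^-1 * d j
          | inr k => - ((c ord0)^-1 * c (lift ord0 k)) end).
rewrite sum_famcat; apply: (scalerI c0); rewrite -[LHS](addrK (\sum_i c (lift ord0 i) *: x i)) gd.
rewrite scalerDr !scaler_sumr -sumrN; congr (_ + _); apply: eq_bigr => i _.
  by rewrite -[lshift _ _]/(unsplit (inl i)) unsplitK scalerA mulVKf.
by rewrite -[rshift _ _]/(unsplit (inr i)) unsplitK scalerA mulrN mulVKf // scaleNr.
Qed.

End Functionals.

Section LiftEndo.
Variables (F : fieldType) (V : lmodType F) (n : nat).
Variables (e : 'I_n -> V) (h : 'I_n -> V -> F).
Hypothesis hlin : forall i, lin_form (h i).
Hypothesis he : forall i j, h i (e j) = (i == j)%:R.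

Definition coords (v : V) : 'cV[F]_n := \col_i h i v.

Definition lift_fun (a : 'M[F]_n) (v : V) : V := \sum_i (a *m coords v) i 0 *: e i.

Lemma coords_lin c x y : coords (c *: x + y) = c *: coords x + coords y.
Proof. by apply/colP => i; rewrite !mxE hlin. Qed.

Fact lift_fun_linear a : linear (lift_fun a).
Proof.
move=> c x y; rewrite /lift_fun coords_lin mulmxDr -scalemxAr scaler_sumr -big_split.
by apply: eq_bigr => i _; rewrite !mxE scalerDl scalerA.
Qed.
HB.instance Definition _ a := GRing.isLinear.Build F V V *:%R (lift_fun a) (lift_fun_linear a).

Definition lift_endo a : endo V := lift_fun a.

Lemma h_sum i (c : 'I_n -> F) : h i (\sum_j c j *: e j) = c i.
Proof.
have -> : h i (\sum_j c j *: e j) = \sum_j c j * h i (e j).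
  apply: (big_ind2 (fun v s => h i v = s)) => [|x s y t <- <-|j _].
  - exact: lin_form0.
  - by have := hlin i 1 x y; rewrite scale1r mul1r.
  by have := hlin i (c j) (e j) 0; rewrite lin_form0 // !addr0.
rewrite (bigD1 i) //= he eqxx mulr1 big1 ?addr0 // => j.
by rewrite he eq_sym => /negbTE->; rewrite mulr0.
Qed.

Lemma coords_lift a v : coords (lift_fun a v) = a *m coords v.
Proof. by apply/colP => i; rewrite mxE h_sum. Qed.

Lemma lift_endoM a b : lift_endo (a * b) = lift_endo a * lift_endo b.
Proof.
apply: endoP => v; rewrite endoME /= /lift_fun.
by apply: eq_bigr => i _; rewrite coords_lift mulmxA.
Qed.

Lemma lift_endoD a b : lift_endo (a + b) = lift_endo a + lift_endo b.
Proof.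
apply: endoP => v; rewrite endoDE /= /lift_fun -big_split.
by apply: eq_bigr => i _; rewrite mulmxDl mxE scalerDl.
Qed.

Lemma lift_endo0 : lift_endo 0 = 0.
Proof.
have := lift_endoD 0 0; rewrite addr0 => /eqP.
by rewrite -subr_eq0 opprD addNKr oppr_eq0 => /eqP.
Qed.

Lemma lift_endo_finite_rank a : finite_rank (lift_endo a).
Proof.
exists n, (fun j => lift_endo a (e j)).
apply/seteqP; split=> [_ [v _ <-]|_ [c ->]]; last first.
  exists (\sum_j c j *: e j) => //; rewrite endo_linsum.
  by apply: eq_bigr => j _; rewrite endo_linZ.
exists (fun j => coords v j 0).
have -> : lift_endo a v = lift_endo a (\sum_j coords v j 0 *: e j).
  rewrite /= /lift_fun; apply: eq_bigr => i _; congr (fun_of_matrix (_ *m _) _ _ *: _).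
  by apply/colP => k; rewrite [RHS]mxE h_sum.
by rewrite endo_linsum; apply: eq_bigr => j _; rewrite endo_linZ.
Qed.

(** The endomorphism acting as x on the span of e and as the identity on the
common kernel of the forms h. *)
Definition extend (x : 'M[F]_n) : endo V := 1 + lift_endo (x - 1).

Lemma extendM x y : extend (x * y) = extend x * extend y.
Proof.
rewrite /extend mulrDl mul1r mulrDr mulr1 -lift_endoM -addrA -!lift_endoD.
congr (_ + lift_endo _); rewrite -[X in X + _ * _]mulr1 -mulrDr.
by rewrite [1 + _]addrC subrK mulrBl mul1r [RHS]addrC addrA subrK.
Qed.

Lemma extend_fscalar x : fscalar (extend x).
Proof.
exists 1, (lift_endo (x - 1)); split; first exact: lift_endo_finite_rank.
by rewrite scale1r.
Qed.

Lemma extend_involution x : involution x -> involution (extend x).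
Proof.
by rewrite /involution /= !expr2 -extendM => ->; rewrite /extend subrr lift_endo0 addr0.
Qed.

Lemma extend_unipotent2 x : unipotent2 x -> unipotent2 (extend x).
Proof.
rewrite /unipotent2 /= !expr2 /extend [1 + _]addrC addrK -lift_endoM => ->.
exact: lift_endo0.
Qed.

End LiftEndo.

(** * Normal form and conclusion *)

Section Main.
Variables (F : fieldType) (V : lmodType F).

Lemma range_coordinates (w : endo V) n (b : 'I_n -> V) : lfree b ->
  range w = lspan b ->
  exists q : 'I_n -> V -> F, (forall i, lin_form (q i)) /\
    (forall v, w v = \sum_i q i v *: b i).
Proof.
move=> bf wb; have /choice[q qP] : forall v, exists c : 'I_n -> F, w v = \sum_i c i *: b i.
  by move=> v; have : lspan b (w v) by rewrite -wb; exists v.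
exists (fun i v => q v i); split=> // i a x y.
apply: (lfree_inj bf (c := q (a *: x + y)) (d := fun j => a * q x j + q y j)).
rewrite -qP linearP !qP scaler_sumr -big_split /=; apply: eq_bigr => j _.
by rewrite scalerDl scalerA.
Qed.

(** The basis consists of a basis b of the range of w, of preimages s of b, and
of one vector k of ker w.  The preimages s0 chosen first may depend linearly on
b, so they are corrected by vectors of ker w which are independent modulo b and
s0.  The coordinate form along s_i is not taken from the dual family but derived
from the coordinates q of w; this is what makes the formula for u valid on all
of V. *)
Lemma SPf_normal_form (u : endo V) : ~ finite_dim [set: V] -> SPf u ->
  exists n (A : 'M[F]_n) (e : 'I_(n + n + 1) -> V) (h : 'I_(n + n + 1) -> V -> F)
      (hlin : forall i, lin_form (h i)),
    [/\ forall i j, h i (e j) = (i == j)%:R,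
        \det A = fdet u & u = extend e hlin (dsum1 (unit_ext A))].
Proof.
move=> Vinf [_ [w [[n0 [b0 wb0]] uw]]].
have [n [b [bf bb0]]] := lspan_basis b0; rewrite -bb0 in wb0.
have [q [qlin wq]] := range_coordinates bf wb0.
have qb v c : w v = \sum_i c i *: b i -> forall i, q i v = c i.
  by rewrite wq => /(lfree_inj bf).
have bE j : b j = \sum_i (i == j)%:R *: b i.
  rewrite (bigD1 j) //= eqxx scale1r big1 ?addr0 // => i /negbTE->.
  by rewrite scale0r.
have /choice[s0 ws0] : forall i, exists v, w v = b i.
  by move=> i; have [v _ vb] : range w (b i) by [rewrite wb0; exact: lspan_mem]; exists v.
have [x xP] := free_modulo n.+1 (famcat b s0) Vinf.
pose U := lspan (famcat b s0).
have Ulin : lin_closed U by exact: lspan_closed.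
have U0 : U 0 by exists (fun=> 0); rewrite big1 // => i _; rewrite scale0r.
have Usum k (c : 'I_k -> F) (f : 'I_k -> V) : (forall i, U (f i)) -> U (\sum_i c i *: f i).
  move=> Uf; apply: big_ind => // [y z Uy Uz|i _].
    by have := Ulin 1 _ _ Uy Uz; rewrite scale1r.
  by have := Ulin (c i) _ _ (Uf i) U0; rewrite addr0.
have Ub i : U (b i) by rewrite -(famcat_l b s0); exact: lspan_mem.
have Us0 i : U (s0 i) by rewrite -(famcat_r b s0); exact: lspan_mem.
pose r i := \sum_j q j (x i) *: s0 j.
pose y i := x i - r i.
have wy i : w (y i) = 0.
  rewrite raddfB /= /r endo_linsum wq; apply/eqP; rewrite subr_eq0; apply/eqP.
  by apply: eq_bigr => j _; rewrite endo_linZ ws0.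
pose s (i : 'I_n) := s0 i + y (lift ord0 i).
have ws i : w (s i) = b i by rewrite raddfD /= ws0 wy addr0.
pose k (_ : 'I_1) := y ord0.
pose e := famcat (famcat b s) k.
have ef : lfree e.
  move=> c; rewrite sum_famcat sum_famcat big_ord1 => c0.
  pose cb j := c (lshift 1 (lshift n j)); pose cs j := c (lshift 1 (rshift n j)).
  pose ck := c (rshift (n + n) 0).
  pose d i := oapp cs ck (unlift ord0 i).
  have sumd : \sum_i d i *: x i
      = ck *: r ord0 + \sum_i cs i *: (r (lift ord0 i) - s0 i) - \sum_i cb i *: b i.
    rewrite big_ord_recl /d unlift_none /=.
    under eq_bigr do rewrite liftK /=.
    have -> : x ord0 = k 0 + r ord0 by rewrite /k /y subrK.
    have -> : \sum_i cs i *: x (lift ord0 i) =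
        \sum_i cs i *: s i + \sum_i cs i *: (r (lift ord0 i) - s0 i).
      rewrite -big_split /=; apply: eq_bigr => i _; rewrite -scalerDr; congr (_ *: _).
      by rewrite /s [RHS]addrC addrA subrK addrC /y subrK.
    have -> : \sum_i cb i *: b i = - (\sum_i cs i *: s i + ck *: k 0).
      by apply/eqP; rewrite -addr_eq0 addrA; apply/eqP.
    rewrite scalerDr opprK addrACA [RHS]addrC; congr (_ + _).
    exact: addrC.
  have d0 : forall i, d i = 0.
    apply: xP; rewrite sumd -scaleN1r addrC.
    apply: (Ulin); first exact: Usum.
    have Ur i : U (r i) by exact: Usum.
    apply: (Ulin) => //; apply: Usum => i; rewrite addrC -scaleN1r.
    exact: Ulin.
  have ck0 : ck = 0 by have := d0 ord0; rewrite /d unlift_none.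
  have cs0 j : cs j = 0 by have := d0 (lift ord0 j); rewrite /d liftK.
  have cb0 : \sum_i cb i *: b i = 0.
    move: c0; rewrite -/ck ck0 scale0r addr0 [X in _ + X]big1 ?addr0 // => j _.
    by rewrite -/(cs j) cs0 scale0r.
  move=> i; case: (split_ordP i) => [i' ->|i' ->]; last by rewrite ord1.
  by case: (split_ordP i') => j ->; [exact: (bf cb cb0) | exact: cs0].
have [h0 [h0lin h0e]] := dual_family ef.
pose A : 'M[F]_n := \matrix_(i, j) ((i == j)%:R + q i (b j)).
pose hp i := h0 (lshift 1 (lshift n i)).
pose hk := h0 (rshift (n + n) 0).
pose hs i v := q i v - \sum_j q i (b j) * hp j v.
pose h (i : 'I_(n + n + 1)) := match fintype.split i with
  | inl i' => match fintype.split i' with inl j => hp j | inr j => hs j end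
  | inr _ => hk end.
have hlin i : lin_form (h i).
  rewrite /h; case: fintype.split => [i'|_]; last exact: h0lin.
  case: fintype.split => [j|j]; first exact: h0lin.
  move=> a v v'; rewrite /hs qlin.
  have -> : \sum_l q j (b l) * hp l (a *: v + v') =
      a * (\sum_l q j (b l) * hp l v) + \sum_l q j (b l) * hp l v'.
    rewrite mulr_sumr -big_split /=; apply: eq_bigr => l _.
    by rewrite /hp h0lin mulrDr mulrCA.
  by ring.
exists n, A, e, h, hlin; split.
- have hpe i j : hp i (e j) = (lshift 1 (lshift n i) == j)%:R by exact: h0e.
  have eb j : e (lshift 1 (lshift n j)) = b j by rewrite /e !famcat_l.
  have es j : e (lshift 1 (rshift n j)) = s j by rewrite /e famcat_l famcat_r.
  have ek j : e (rshift (n + n) j) = k j by rewrite /e famcat_r.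
  have hse i j : hs i (e j) = (lshift 1 (rshift n i) == j)%:R.
    rewrite /hs; under eq_bigr do rewrite hpe.
    case: (split_ordP j) => [j' ->|j' ->].
      case: (split_ordP j') => l ->; rewrite ?eb ?es.
        rewrite (bigD1 l) //= eqxx mulr1 big1 ?addr0 ?subrr => [|m ml].
          by rewrite eq_lshift eq_rlshift.
        by rewrite !eq_lshift (negbTE ml) mulr0.
      rewrite big1 ?subr0 => [|m _]; last by rewrite eq_lshift eq_lrshift mulr0.
      rewrite eq_lshift eq_rshift; apply: (qb _ (fun i => (i == l)%:R)).
      by rewrite ws bE.
    rewrite big1 ?subr0 => [|m _]; last by rewrite eq_lrshift mulr0.
    rewrite eq_lrshift ek; apply: (qb _ (fun=> 0)).
    by rewrite wy big1 // => m _; rewrite scale0r.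
  have spl p m (l : 'I_p) : fintype.split (lshift m l) = inl l := unsplitK (inl l).
  have spr p m (l : 'I_m) : fintype.split (rshift p l) = inr l := unsplitK (inr l).
  move=> i j; case: (split_ordP i) => [i' ->|i' ->]; rewrite /h ?spl ?spr; last first.
    by rewrite /hk h0e ord1.
  by case: (split_ordP i') => l ->; rewrite ?spl ?spr.
- symmetry; apply: fdetP; exists n, b, A; split=> //.
    move=> _ [v _ <-]; rewrite uw addrC addKr -wb0; by exists v.
  move=> i; rewrite uw endoDE endo1E wq {1}bE -big_split /=.
  by apply: eq_bigr => j _; rewrite mxE scalerDl.
apply: endoP => v; rewrite uw /extend !endoDE; congr (_ + _).
pose cp : 'cV[F]_n := \col_i hp i v; pose cs : 'cV[F]_n := \col_i hs i v.
rewrite -[lift_endo _ _ _ _]/(lift_fun e h _ v) /lift_fun.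
have -> : coords h v = col_mx (col_mx cp cs) (\col_i hk v).
  apply/colP => i; rewrite !mxE /h; case: fintype.split => [i'|i']; rewrite !mxE //.
  by case: fintype.split => l; rewrite !mxE.
have -> : (dsum1 (unit_ext A) - 1) *m col_mx (col_mx cp cs) (\col_i hk v)
    = col_mx (col_mx ((A - 1%:M) *m cp + cs) 0) 0.
  have J1 : unit_ext A - 1%:M = block_mx (A - 1%:M) 1%:M 0 0.
    by rewrite scalar_mx_block opp_block_mx add_block_mx !subr0 subrr.
  rewrite -block_mx1 opp_block_mx add_block_mx J1 !subrr mul_block_col.
  by rewrite !mul0mx !addr0 mul_block_col !mul0mx mul1mx !addr0.
rewrite sum_famcat sum_famcat [X in _ + X]big1 ?addr0 => [|i _]; last first.
  by rewrite col_mxEd mxE scale0r.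
rewrite [X in _ + X]big1 ?addr0 => [|i _]; last first.
  by rewrite col_mxEu col_mxEd mxE scale0r.
rewrite wq; apply: eq_bigr => i _; congr (_ *: _).
rewrite !col_mxEu mxE [cs i 0]mxE /hs addrC -[LHS](subrK (\sum_j q i (b j) * hp j v)).
congr (_ + _); rewrite mxE; apply: eq_bigr => j _; rewrite !mxE.
by rewrite addrAC subrr add0r.
Qed.

End Main.

Theorem proposition1p14 (F : fieldType) (V : lmodType F)
    (Vinf : ~ finite_dim [set: V]) (u : endo V) (uSP : SPf u)
    (udet : fdet u = 1 \/ fdet u = -1) :
  let I : set (endo V) := @fscalar F V `&` @involution (endo V) in
  let U : set (endo V) := @fscalar F V `&` @unipotent2 (endo V) in
  [/\ prod3 I I I u,
      [/\ prod3 U I I u, prod3 I U I u & prod3 I I U u],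
      [/\ prod3 I U U u, prod3 U I U u & prod3 U U I u]
    & (fdet u = 1 -> prod3 U U U u)].
Proof.
move=> I U; have [n [A [e [h [hlin [he dA uE]]]]]] := SPf_normal_form Vinf uSP.
rewrite -dA in udet *; rewrite {}uE; set M := dsum1 (unit_ext A).
pose inv := @involution 'M[F]_(n + n + 1); pose uni := @unipotent2 'M[F]_(n + n + 1).
have toI x : inv x -> I (extend e hlin x).
  by move=> xI; split; [exact: extend_fscalar | exact: extend_involution].
have toU x : uni x -> U (extend e hlin x).
  by move=> xU; split; [exact: extend_fscalar | exact: extend_unipotent2].
have push (X Y Z : set 'M[F]_(n + n + 1)) (X' Y' Z' : set (endo V)) :
    (forall x, X x -> X' (extend e hlin x)) -> (forall x, Y x -> Y' (extend e hlin x)) ->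
    (forall x, Z x -> Z' (extend e hlin x)) ->
    prod3 X Y Z M -> prod3 X' Y' Z' (extend e hlin M).
  move=> hX hY hZ [x [y [z [Xx Yy Zz ->]]]].
  exists (extend e hlin x), (extend e hlin y), (extend e hlin z).
  by split; [exact: hX | exact: hY | exact: hZ | rewrite !extendM].
have III : prod3 inv inv inv M := unit_ext_III udet.
have UII : prod3 uni inv inv M := unit_ext_UII udet.
have IUU : prod3 inv uni uni M := unit_ext_IUU udet.
have IUI : prod3 inv uni inv M.
  exact: (prod3_swap12 (@unipotent2_conj _) (@involution_inv _) UII).
have UIU : prod3 uni inv uni M.
  exact: (prod3_swap12 (@involution_conj _) (@unipotent2_inv _) IUU).
have IIU : prod3 inv inv uni M.
  exact: (prod3_swap23 (@unipotent2_conj _) (@involution_inv _) IUI).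
have UUI : prod3 uni uni inv M.
  exact: (prod3_swap23 (@involution_conj _) (@unipotent2_inv _) UIU).
split; [|split|split|].
- exact: push III.
- exact: push UII.
- exact: push IUI.
- exact: push IIU.
- exact: push IUU.
- exact: push UIU.
- exact: push UUI.
by move=> /unit_ext_UUU; exact: push.
Qed.
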